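(* Let $\Omega\subset\mathbb{R}^3$ be a bounded domain and let $\rho_\pm,\eta_\pm,\sigma_\pm,\lambda,m>0$ be constants, $\widehat{\lambda}=\frac{3\lambda}{2\sqrt{2}}$, $\rho_d=\frac{\rho_+-\rho_-}{2}$, and let $\boldsymbol{B},\boldsymbol{g}\in\mathbb{R}^3$ be constant vectors, $\boldsymbol{g}=(0,0,-g)^\top$ with $g>0$. For $\chi\in\{\rho,\eta,\sigma\}$ put $\chi(\phi)=\frac{\chi_+-\chi_-}{2}\phi+\frac{\chi_++\chi_-}{2}$, and let $\mathbb{D}(\boldsymbol{u})=\frac12(\nabla\boldsymbol{u}+(\nabla\boldsymbol{u})^\top)$ and $\mathbb{I}$ be the identity tensor. For $\epsilon>0$ consider the diffuse interface model in $\Omega$ with unknowns $(\phi,\mu,\boldsymbol{u},p,\boldsymbol{J},V)$ and constant mobility $m_\epsilon$: $$\begin{aligned} \partial_t\phi+\nabla\cdot(\phi\boldsymbol{u})&=\nabla\cdot(m_\epsilon\nabla\mu),\\ \mu&=-\widehat{\lambda}\epsilon\Delta\phi+\widehat{\lambda}\epsilon^{-1}(\phi^3-\phi),\\ \rho(\phi)\partial_t\boldsymbol{u}+\big(\rho(\phi)\boldsymbol{u}-\rho_d m_\epsilon\nabla\mu\big)\cdot\nabla\boldsymbol{u}&=\nabla\cdot\big(2\eta(\phi)\mathbb{D}(\boldsymbol{u})-p\mathbb{I}\big)+\mu\nabla\phi+\boldsymbol{J}\times\boldsymbol{B}+\rho(\phi)\boldsymbol{g},\\ \nabla\cdot\boldsymbol{u}&=0,\\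 \boldsymbol{J}&=\sigma(\phi)(\boldsymbol{E}+\boldsymbol{u}\times\boldsymbol{B}),\qquad \boldsymbol{E}=-\nabla V,\\ \nabla\cdot\boldsymbol{J}&=0. \end{aligned}$$ Assume the scaling law $m_\epsilon=m\epsilon^2$ (that is, $m_\epsilon=\mathcal{O}(\epsilon^2)$). Then the sharp interface limit of this model as $\epsilon\to0$, in the sense of formally matched asymptotic expansions (defined in the context), is the following sharp interface system: the leading-order outer fields $\boldsymbol{u}=\boldsymbol{u}_0^\pm$, $p=p_0^\pm$, $\boldsymbol{J}=\boldsymbol{J}_0^\pm$, $V=V_0^\pm$ in $\Omega_\pm(t)$, together with $\boldsymbol{E}=-\nabla V$, satisfy $$\begin{aligned} \rho_\pm(\partial_t\boldsymbol{u}+\boldsymbol{u}\cdot\nabla\boldsymbol{u})&=\nabla\cdot(2\eta_\pm\mathbb{D}(\boldsymbol{u})-p\mathbb{I})+\boldsymbol{J}\times\boldsymbol{B}+\rho_\pm\boldsymbol{g}&&\text{in }\Omega_\pm(t),\\ \nabla\cdot\boldsymbol{u}&=0&&\text{in }\Omega_\pm(t),\\ \boldsymbol{J}&=\sigma_\pm(\boldsymbol{E}+\boldsymbol{u}\times\boldsymbol{B})&&\text{in }\Omega_\pm(t),\\ \boldsymbol{E}&=-\nabla V&&\text{in }\Omega_\pm(t),\\ \nabla\cdot\boldsymbol{J}&=0&&\text{in }\Omega_\pm(t),\\ [\![2\eta\mathbb{D}(\boldsymbol{u})-p\mathbb{I}]\!]\boldsymbol{n}_\Gamma&=-\lambda\kappa\boldsymbol{n}_\Gamma&&\text{on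 }\Gamma(t),\\ [\![\boldsymbol{u}]\!]&=\boldsymbol{0}&&\text{on }\Gamma(t),\\ [\![\boldsymbol{J}\cdot\boldsymbol{n}_\Gamma]\!]&=0&&\text{on }\Gamma(t),\\ [\![V]\!]&=0&&\text{on }\Gamma(t),\\ V_\Gamma&=\boldsymbol{u}\cdot\boldsymbol{n}_\Gamma&&\text{on }\Gamma(t), \end{aligned}$$ where $\eta=\eta_\pm$ in $\Omega_\pm(t)$.
   Context: Boundary conditions of the diffuse interface model on $\partial\Omega$ (outward unit normal $\boldsymbol{n}$): $\boldsymbol{u}=\boldsymbol{0}$, $\boldsymbol{J}\cdot\boldsymbol{n}=0$, $\nabla\phi\cdot\boldsymbol{n}=0$, $\nabla\mu\cdot\boldsymbol{n}=0$; initial data $\boldsymbol{u}(0)=\boldsymbol{u}^0$, $\phi(0)=\phi^0$. Geometry. For a family of solutions $(\phi_\epsilon,\mu_\epsilon,\boldsymbol{u}_\epsilon,p_\epsilon,\boldsymbol{J}_\epsilon,V_\epsilon)$, write $\Omega_+(t)=\{\phi_\epsilon>0\}$, $\Omega_-(t)=\{\phi_\epsilon<0\}$, $\Gamma(t)=\{\phi_\epsilon=0\}$. In the formal limit $\Gamma(t)$ is a smooth evolving hypersurface separating the two subdomains, each containing only one of the two fluids. Let $d$ be the signed distance to $\Gamma(t)$, with $d>0$ in $\Omega_+(t)$. Set $\boldsymbol{n}_\Gamma=\nabla d$ (unit normal pointing into $\Omega_+(t)$), $V_\Gamma=-\partial_t d$ (normal velocity), and $\kappa=-\Delta d$ on $\Gamma(t)$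 (mean curvature, the sum of principal curvatures with this sign). The jump is $[\![\chi]\!]=\chi_+-\chi_-$, where $\chi_\pm$ is the trace on $\Gamma(t)$ from $\Omega_\pm(t)$. Sharp interface limit in the sense of formally matched asymptotic expansions. All expansions are formal power series in $\epsilon$ with smooth coefficients; they are substituted into the model equations (with the material coefficients expanded accordingly) and the equations are required to hold order by order in $\epsilon$. (a) Outer expansions. Away from $\Gamma(t)$, in $\Omega_\pm(t)$, each $\chi_\epsilon\in\{\phi_\epsilon,\boldsymbol{u}_\epsilon,p_\epsilon,\boldsymbol{J}_\epsilon,V_\epsilon\}$ has the form $\chi_\epsilon=\chi_0^\pm+\epsilon\chi_1^\pm+\epsilon^2\chi_2^\pm+\cdots$, and $\mu_\epsilon=\epsilon^{-1}\mu_0^\pm+\mu_1^\pm+\epsilon\mu_2^\pm+\cdots$ with $\mu_0^\pm=\widehat{\lambda}((\phi_0^\pm)^3-\phi_0^\pm)$. Here $\phi_0^+>0$ and $\phi_0^-<0$. (b) Inner expansions. Near $\Gamma(t)$ use the stretched variable $z=d/\epsilon$ together with tangential coordinates on $\Gamma(t)$ and $t$. In these variables each $\chi_\epsilon\in\{\phi_\epsilon,\boldsymbol{u}_\epsilon,p_\epsilon,\boldsymbol{J}_\epsilon,V_\epsilon\}$ has the form $\chi_\epsilon=\chi_0^i+\epsilon\chi_1^i+\epsilon^2\chi_2^i+\cdots$, and $\mu_\epsilon=\epsilon^{-1}\mu_0^i+\mu_1^i+\epsilon\mu_2^i+\cdots$, with coefficients depending on $z\in\mathbb{R}$, the tangential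 coordinates and $t$, where $$\mu_0^i=\widehat{\lambda}\big(-\partial_{zz}\phi_0^i+(\phi_0^i)^3-\phi_0^i\big),\qquad \mu_1^i=\widehat{\lambda}\big(-\partial_{zz}\phi_1^i+\kappa\partial_z\phi_0^i+(3(\phi_0^i)^2-1)\phi_1^i\big).$$ Derivatives transform by $$\partial_t\chi=-\epsilon^{-1}V_\Gamma\partial_z\chi+\mathcal{O}(1),\quad \nabla\chi=\epsilon^{-1}\partial_z\chi\,\boldsymbol{n}_\Gamma+\nabla_\Gamma\chi+\mathcal{O}(\epsilon),$$ $$\nabla\cdot\boldsymbol{\chi}=\epsilon^{-1}\partial_z\boldsymbol{\chi}\cdot\boldsymbol{n}_\Gamma+\nabla_\Gamma\cdot\boldsymbol{\chi}+\mathcal{O}(\epsilon),\quad \Delta\chi=\epsilon^{-2}\partial_{zz}\chi-\epsilon^{-1}\kappa\partial_z\chi+\mathcal{O}(1),$$ for scalar $\chi$ and vector-valued $\boldsymbol{\chi}$, where $\nabla_\Gamma$ is the surface gradient and $\nabla_\Gamma\cdot$ the surface divergence. Since $\Gamma(t)$ is the zero level set of $\phi_\epsilon$, $\phi_0^i=0$ at $z=0$. (c) Matching conditions at $\Gamma(t)$: $\lim_{z\to\pm\infty}\chi_0^i=\chi_0^\pm$, $\lim_{z\to\pm\infty}\partial_z\chi_0^i=0$, $\lim_{z\to\pm\infty}\partial_z\chi_1^i=\nabla\chi_0^\pm\cdot\boldsymbol{n}_\Gamma$, where the right-hand sides are traces on $\Gamma(t)$ from $\Omega_\pm(t)$ and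 $\chi$ stands for any of the expanded quantities (with $\mu_0,\mu_1$ the coefficients of $\epsilon^{-1},\epsilon^0$ for $\mu_\epsilon$). ''The sharp interface limit of the model is a given system'' means: whenever a family of solutions admits outer and inner expansions as in (a), (b) satisfying the matching conditions (c), the leading-order outer coefficients $(\boldsymbol{u}_0^\pm,p_0^\pm,\boldsymbol{J}_0^\pm,V_0^\pm)$ and $\Gamma(t)$ satisfy that system. *)

(* Defs.v *)
From HB Require Import structures.
From mathcomp Require Import all_boot all_order all_algebra.
From mathcomp Require Import all_classical all_reals all_analysis.
Set Implicit Arguments.
Unset Strict Implicit.
Unset Printing Implicit Defensive.
Import Order.TTheory GRing.Theory Num.Theory.
Import numFieldNormedType.Exports.
Local Open Scope classical_set_scope.
Local Open Scope ring_scope.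

Inductive side := Plus | Minus.

Definition sgn (R : realType) (s : side) : R := if s is Plus then 1 else -1.

Definition infty (R : realType) (s : side) : set_system R :=
  if s is Plus then pinfty_nbhs R else ninfty_nbhs R.

Record parameters (R : realType) := MkParameters {
  rho_ : side -> R;
  eta_ : side -> R;
  sigma_ : side -> R;
  lambda : R;
  mob : R;
  grav : R;
  magB : 'rV[R]_3 }.

Definition parameters_pos (R : realType) (c : parameters R) : Prop :=
  [/\ forall s, 0 < rho_ c s, forall s, 0 < eta_ c s, forall s, 0 < sigma_ c s &
    [/\ 0 < lambda c, 0 < mob c & 0 < grav c]].

Definition lambda_hat (R : realType) (c : parameters R) : R :=
  3 * lambda c / (2 * Num.sqrt 2).

Definition rho_d (R : realType) (c : parameters R) : R :=
  (rho_ c Plus - rho_ c Minus) / 2.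

Definition gvec (R : realType) (c : parameters R) : 'rV[R]_3 :=
  - grav c *: delta_mx 0 (inord 2).

(* The same differential expressions are used for ordinary functions, for
   formal series in the outer region and for formal series in the inner region.
   Hence they are written over any module with a product and derivations;
   [ceqv] is the equality required of an equation that holds on the region under
   consideration.  Nothing is assumed of the operations: only the concrete
   instances [function_calculus], [outer_calculus] and [inner_calculus] are
   used. *)

Record calculus (R : realType) := Calculus {
  car :> lmodType R;
  cmul : car -> car -> car;
  cone : car;
  cdt : car -> car;
  cdx : 'I_3 -> car -> car;
  ceqv : car -> car -> Prop }.

Section VectorCalculus.
Variables (R : realType) (C : calculus R).
Implicit Types (f p eta : C) (u w : 'I_3 -> C) (B : 'rV[R]_3).

Definition vdiv u : C := \sum_i cdx i (u i).

Definition lap f : C := vdiv (fun i => cdx i f).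

Definition advect w f : C := \sum_j cmul (w j) (cdx j f).

Definition symgrad u (i j : 'I_3) : C := 2^-1 *: (cdx i (u j) + cdx j (u i)).

(* 2 eta D(u) - p I *)
Definition stress eta u p (i j : 'I_3) : C :=
  2 *: cmul eta (symgrad u i j) - (i == j)%:R *: p.

Definition tdiv (S : 'I_3 -> 'I_3 -> C) (i : 'I_3) : C :=
  \sum_j cdx j (S i j).

(* u x B; addition in 'I_3 is modulo 3 *)
Definition cross u B (i : 'I_3) : C :=
  B 0 (i + 1 + 1) *: u (i + 1) - B 0 (i + 1) *: u (i + 1 + 1).

Definition cube_minus_id f : C := cmul f (cmul f f) - f.

(* chi(phi) = (chi_+ - chi_-) / 2 * phi + (chi_+ + chi_-) / 2 *)
Definition affine_mix (chi : side -> R) f : C :=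
  ((chi Plus - chi Minus) / 2) *: f + ((chi Plus + chi Minus) / 2) *: cone C.

End VectorCalculus.

Record fields (X : Type) := Fields {
  phi : X;
  mu : X;
  vel : 'I_3 -> X;
  prs : X;
  cur : 'I_3 -> X;
  pot : X }.

(* [eps n f] stands for eps^n f; the mobility is m_eps = m eps^2. *)
Record diffuse_interface_model (R : realType) (c : parameters R)
    (C : calculus R) (eps : int -> C -> C) (F : fields C) : Prop := {
  dim_phase :
    ceqv (cdt (phi F) + vdiv (fun i => cmul (phi F) (vel F i)))
         (vdiv (fun i => mob c *: eps 2 (cdx i (mu F))));
  dim_mu :
    ceqv (mu F)
      (- (lambda_hat c *: eps 1 (lap (phi F)))
       + lambda_hat c *: eps (-1) (cube_minus_id (phi F)));
  dim_momentum : forall i : 'I_3,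
    let rho := affine_mix (rho_ c) (phi F) in
    let eta := affine_mix (eta_ c) (phi F) in
    ceqv
      (cmul rho (cdt (vel F i))
       + advect (fun j => cmul rho (vel F j)
                  - rho_d c *: (mob c *: eps 2 (cdx j (mu F)))) (vel F i))
      (tdiv (stress eta (vel F) (prs F)) i + cmul (mu F) (cdx i (phi F))
       + cross (cur F) (magB c) i + gvec c 0 i *: rho);
  dim_incompressible : ceqv (vdiv (vel F)) 0;
  dim_ohm : forall i : 'I_3,
    let E := fun j => - cdx j (pot F) in
    ceqv (cur F i)
      (cmul (affine_mix (sigma_ c) (phi F))
            (E i + cross (vel F) (magB c) i));
  dim_charge : ceqv (vdiv (cur F)) 0 }.

Section SpaceTime.
Variable R : realType.

(* (t, x), and (t, s, z) with z the stretched normal variable *)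
Definition spacetime : normedModType R := (R^o * 'rV[R]_3)%type.
Definition stretched : normedModType R := (spacetime * R^o)%type.

Definition dir_t : spacetime := (1, 0).
Definition dir_x (i : 'I_3) : spacetime := (0, delta_mx 0 i).
Definition dir_z : stretched := (0, 1).

Definition dot (v w : 'rV[R]_3) : R := \sum_i v 0 i * w 0 i.
(* Euclidean length; the library norm on row vectors is the sup norm *)
Definition elen (v : 'rV[R]_3) : R := Num.sqrt (dot v v).

Definition sgrad (f : spacetime -> R^o) (q : spacetime) : 'rV[R]_3 :=
  \row_i 'D_(dir_x i) f q.

Fixpoint Ck (E : normedModType R) (k : nat) (U : set E) (f : E -> R^o) : Prop :=
  match k with
  | 0 => forall q, U q -> {for q, continuous f}
  | k'.+1 => (forall q, U q -> differentiable f q) /\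
             (forall v : E, Ck k' U ('D_v f))
  end.

(* Smoothness on a set that need not be open: smoothness of the given
   extension on an open neighbourhood.  On a subdomain together with its
   interface this is smoothness up to the interface, and the traces of the
   function and of its derivatives are then their values on the interface. *)
Definition smooth_near (E : normedModType R) (A : set E) (f : E -> R^o) : Prop :=
  exists U : set E, [/\ open U, A `<=` U & forall k, Ck k U f].

End SpaceTime.

Arguments dir_t {R}.
Arguments dir_x {R}.
Arguments dir_z {R}.

(* The evolving interface is described by its signed distance [d]; times range
   over [0, T). *)

Section Geometry.
Variables (R : realType) (Omega : set 'rV[R]_3) (T : R) (d : spacetime R -> R^o).

Definition subdomain (s : side) (t : R) : set 'rV[R]_3 :=
  [set x | Omega x /\ 0 < sgn R s * d (t, x)].

Definition interface (t : R) : set 'rV[R]_3 :=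
  [set x | Omega x /\ d (t, x) = 0].

Definition bulk (s : side) : set (spacetime R) :=
  [set q | 0 <= q.1 < T /\ subdomain s q.1 q.2].

Definition front : set (spacetime R) :=
  [set q | 0 <= q.1 < T /\ interface q.1 q.2].

Definition n_Gamma (q : spacetime R) : 'rV[R]_3 := sgrad d q.
Definition V_Gamma (q : spacetime R) : R := - 'D_dir_t d q.
Definition kappa (q : spacetime R) : R :=
  - \sum_i 'D_(dir_x i) ('D_(dir_x i) d) q.

(* The unit length of the gradient on the zero level set is what makes that
   level set a hypersurface. *)
Record evolving_interface : Prop := {
  ei_open : open Omega;
  ei_connected : connected Omega;
  ei_bounded : bounded_set Omega;
  ei_time : 0 < T;
  ei_continuous :
    {within [set q : spacetime R | 0 <= q.1 < T /\ Omega q.2], continuous d};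
  ei_two_sides : forall s t, 0 <= t < T -> subdomain s t !=set0;
  ei_distance : forall t x, 0 <= t < T -> Omega x ->
    `|d (t, x)| = inf [set elen (x - y) | y in interface t];
  ei_smooth : smooth_near front d;
  ei_unit : forall q, front q -> elen (n_Gamma q) = 1 }.

(* Linearization of the domain, resp. of its complement, at a boundary point:
   at a point where the boundary is C^1 the only such vector is the outward
   unit normal. *)
Definition outward_unit_normal (y nu : 'rV[R]_3) : Prop :=
  elen nu = 1 /\
  forall e, 0 < e -> \forall x \near y,
    (Omega x -> dot (x - y) nu <= e * elen (x - y)) /\
    (~ Omega x -> - (e * elen (x - y)) <= dot (x - y) nu).

End Geometry.

(* [a : int -> E -> R] stands for the formal Laurent series sum_k eps^k a_k.  All
   series in use have finitely many terms of negative order, so that the finitely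
   supported sums below are the actual sums. *)

Section Series.
Variable R : realType.

Definition series_on (E : Type) : lmodType R := (int -> E -> R^o).

(* eps^q (c_0 + eps c_1 + eps^2 c_2 + ...) *)
Definition power_series (E : Type) (q : int) (c : nat -> E -> R^o)
    : series_on E :=
  fun k => if k - q is Posz n then c n else 0.

Definition smul (E : Type) (a b : series_on E) : series_on E :=
  fun k q => \sum_(i \in [set: int]) a i q * b (k - i) q.

Definition sone (E : Type) : series_on E := fun k q => (k == 0)%:R.

Definition seps (E : Type) (n : int) (a : series_on E) : series_on E :=
  fun k => a (k - n).

Definition seqv (E : Type) (A : set E) (a b : series_on E) : Prop :=
  forall k q, A q -> a k q = b k q.

Definition expand (E : Type) (F : fields (nat -> E -> R^o))
    : fields (series_on E) :=
  Fields (power_series 0 (phi F)) (power_series (-1) (mu F))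
    (fun i => power_series 0 (vel F i)) (power_series 0 (prs F))
    (fun i => power_series 0 (cur F i)) (power_series 0 (pot F)).

Definition outer_calculus (A : set (spacetime R)) : calculus R :=
  @Calculus R (series_on (spacetime R)) (@smul _) (@sone _)
    (fun a k => 'D_dir_t (a k)) (fun i a k => 'D_(dir_x i) (a k)) (seqv A).

(* ordinary functions instead of series *)
Definition function_calculus (A : set (spacetime R)) : calculus R :=
  @Calculus R (spacetime R -> R^o) (fun f g q => f q * g q) (fun _ => 1)
    (fun f => 'D_dir_t f) (fun i f => 'D_(dir_x i) f) (fun f g => forall q, A q -> f q = g q).

End Series.

(* A coefficient is a function X(t, s, z) with s on the interface; its extension
   X^(t, x, z) = X(t, pi(t, x), z), with pi(t, x) = x - d grad d the nearest
   point of the interface, is constant along normals.  For the function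
   x |-> X^(t, x, d(t, x) / eps) and v either the time direction or a space
   direction,
     D_v [X^(., d / eps)] = eps^-1 (D_v d) (d_z X)^ + (D_v X^)(., d / eps).
   At x = s + eps z n_Gamma the factor D_v d has the same value as at s, because
   |grad d| = 1 near the interface, and the second term is Taylor expanded along
   the normal:
     sum_j eps^j z^j / j! (d/dr)^j |_(r = 0) (D_v X^)(t, s + r n_Gamma, z).
   For v the time direction D_v d = - V_Gamma; for v a space direction
   D_v d = n_Gamma . v, and the term j = 0 is the surface gradient.  Hence
     grad = eps^-1 n_Gamma d_z + grad_Gamma + O(eps),
   and iterating gives the expansion eps^-2 d_zz - eps^-1 kappa d_z + O(1) of the
   Laplacian. *)

Section InnerCalculus.
Variables (R : realType) (d : spacetime R -> R^o).

Definition foot (q : spacetime R) : spacetime R :=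
  (q.1, q.2 - d q *: sgrad d q).

Definition normal_ext (X : stretched R -> R^o) (z : R) (q : spacetime R) : R^o :=
  X (foot q, z).

Definition taylor_normal (f : R -> spacetime R -> R^o) (j : nat)
    (w : stretched R) : R^o :=
  let: (q, z) := w in
  z ^+ j / (j`!)%:R *
    derive1n j (fun r : R => f z (q.1, q.2 + r *: n_Gamma d q)) 0.

Definition inner_deriv (v : spacetime R) (a : series_on R (stretched R))
    : series_on R (stretched R) :=
  fun k w => 'D_v d w.1 * 'D_dir_z (a (k + 1)) w +
    \sum_(j \in [set: nat])
      taylor_normal (fun z => 'D_v (normal_ext (a (k - j%:Z)) z)) j w.

Definition inner_calculus (A : set (stretched R)) : calculus R :=
  @Calculus R (series_on R (stretched R)) (@smul R _) (@sone R _)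
    (inner_deriv dir_t) (fun i => inner_deriv (dir_x i)) (seqv A).

End InnerCalculus.

Section Expansions.
Variables (R : realType) (c : parameters R).
Variables (Omega : set 'rV[R]_3) (T : R) (d : spacetime R -> R^o).

Definition all_fields (X : Type) (Q : X -> Prop) (F : fields X) : Prop :=
  [/\ Q (phi F), Q (mu F), forall i, Q (vel F i), Q (prs F) &
      (forall i, Q (cur F i)) /\ Q (pot F)].

Definition all_fields2 (X Y : Type) (Q : X -> Y -> Prop)
    (F : fields X) (G : fields Y) : Prop :=
  [/\ Q (phi F) (phi G), Q (mu F) (mu G), forall i, Q (vel F i) (vel G i),
      Q (prs F) (prs G) &
      (forall i, Q (cur F i) (cur G i)) /\ Q (pot F) (pot G)].

(* Order by order boundary conditions for the outer expansion on the part of the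
   boundary of Omega away from the interface. *)
Definition boundary_conditions (s : side)
    (F : fields (nat -> spacetime R -> R^o)) : Prop :=
  forall t y, 0 <= t < T -> (closure Omega `\` Omega) y ->
    ~ closure (interface Omega d t) y ->
  let at_y := within (subdomain Omega d s t) (nbhs y) in
  forall k : nat,
    (forall i, (fun x => vel F i k (t, x)) @ at_y --> (0 : R^o)) /\
    (forall nu, outward_unit_normal Omega y nu ->
      [/\ (fun x => \sum_i cur F i k (t, x) * nu 0 i) @ at_y --> (0 : R^o),
          (fun x => dot (sgrad (phi F k) (t, x)) nu) @ at_y --> (0 : R^o) &
          (fun x => dot (sgrad (mu F k) (t, x)) nu) @ at_y --> (0 : R^o)]).

Record outer_expansion (phi_init : nat -> 'rV[R]_3 -> R)
    (vel_init : 'I_3 -> nat -> 'rV[R]_3 -> R)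
    (s : side) (F : fields (nat -> spacetime R -> R^o)) : Prop := {
  oe_smooth : all_fields
    (fun a => forall k, smooth_near (bulk Omega T d s `|` front Omega T d) (a k)) F;
  oe_model : diffuse_interface_model c
    (C := outer_calculus (bulk Omega T d s)) (@seps R _) (expand F);
  oe_mu0 : forall q, bulk Omega T d s q ->
    mu F 0%N q = lambda_hat c * (phi F 0%N q ^+ 3 - phi F 0%N q);
  oe_sign : forall q, bulk Omega T d s q -> 0 < sgn R s * phi F 0%N q;
  oe_boundary : boundary_conditions s F;
  oe_initial : forall k x, subdomain Omega d s 0 x ->
    phi F k (0, x) = phi_init k x /\
    forall i, vel F i k (0, x) = vel_init i k x }.

Definition layer : set (stretched R) := [set w | front Omega T d w.1].

Record inner_expansion (G : fields (nat -> stretched R -> R^o)) : Prop := {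
  ie_smooth : all_fields (fun a => forall k, smooth_near layer (a k)) G;
  ie_model : diffuse_interface_model c
    (C := inner_calculus d layer) (@seps R _) (expand G);
  ie_mu0 : forall w, layer w ->
    mu G 0%N w = lambda_hat c *
      (- 'D_dir_z ('D_dir_z (phi G 0%N)) w + phi G 0%N w ^+ 3 - phi G 0%N w);
  ie_mu1 : forall w, layer w ->
    mu G 1%N w = lambda_hat c *
      (- 'D_dir_z ('D_dir_z (phi G 1%N)) w
       + kappa d w.1 * 'D_dir_z (phi G 0%N) w
       + (3 * phi G 0%N w ^+ 2 - 1) * phi G 1%N w);
  ie_center : forall q, front Omega T d q -> phi G 0%N (q, 0) = 0 }.

Definition matched (s : side) (ci : nat -> stretched R -> R^o)
    (co : nat -> spacetime R -> R^o) : Prop :=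
  forall q, front Omega T d q ->
  [/\ (fun z : R => ci 0%N (q, z)) @ @infty R s --> co 0%N q,
      (fun z : R => 'D_dir_z (ci 0%N) (q, z)) @ @infty R s --> (0 : R^o) &
      (fun z : R => 'D_dir_z (ci 1%N) (q, z)) @ @infty R s -->
        (dot (sgrad (co 0%N) q) (n_Gamma d q) : R^o)].

End Expansions.

Record sharp_interface_system (R : realType) (c : parameters R)
    (Omega : set 'rV[R]_3) (T : R) (d : spacetime R -> R^o)
    (u : side -> 'I_3 -> spacetime R -> R^o) (p : side -> spacetime R -> R^o)
    (J E : side -> 'I_3 -> spacetime R -> R^o) (V : side -> spacetime R -> R^o)
    : Prop := {
  si_momentum : forall s (i : 'I_3),
    let C := function_calculus (bulk Omega T d s) in
    ceqv (c := C)
      (rho_ c s *: (cdt (c := C) (u s i) + advect (C := C) (u s) (u s i)))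
      (tdiv (C := C) (stress (eta_ c s *: cone C) (u s) (p s)) i
       + cross (C := C) (J s) (magB c) i + (rho_ c s * gvec c 0 i) *: cone C);
  si_incompressible : forall s,
    let C := function_calculus (bulk Omega T d s) in
    ceqv (c := C) (vdiv (C := C) (u s)) 0;
  si_ohm : forall s (i : 'I_3),
    let C := function_calculus (bulk Omega T d s) in
    ceqv (c := C) (J s i)
      (sigma_ c s *: (E s i + cross (C := C) (u s) (magB c) i));
  si_electric : forall s (i : 'I_3),
    let C := function_calculus (bulk Omega T d s) in
    ceqv (c := C) (E s i) (- cdx (c := C) i (V s));
  si_charge : forall s,
    let C := function_calculus (bulk Omega T d s) in
    ceqv (c := C) (vdiv (C := C) (J s)) 0;
  si_stress_jump : forall q (i : 'I_3), front Omega T d q ->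
    let S s := stress (C := function_calculus (bulk Omega T d s))
                 (eta_ c s *: cone _) (u s) (p s) in
    \sum_j (S Plus i j q - S Minus i j q) * n_Gamma d q 0 j
      = - (lambda c * kappa d q * n_Gamma d q 0 i);
  si_velocity_jump : forall q (i : 'I_3), front Omega T d q ->
    u Plus i q - u Minus i q = 0;
  si_current_jump : forall q, front Omega T d q ->
    \sum_i J Plus i q * n_Gamma d q 0 i - \sum_i J Minus i q * n_Gamma d q 0 i
      = 0;
  si_potential_jump : forall q, front Omega T d q -> V Plus q - V Minus q = 0;
  (* the trace of u may be taken from either side *)
  si_kinematic : forall s q, front Omega T d q ->
    V_Gamma d q = \sum_i u s i q * n_Gamma d q 0 i }.

(* Main.v *)
Require Import Defs.
From mathcomp Require Import all_boot all_order all_algebra.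
From mathcomp Require Import all_classical all_reals all_analysis.
From mathcomp Require Import ring lra zify.
Import Order.TTheory GRing.Theory Num.Theory.
Import numFieldNormedType.Exports.
Local Open Scope classical_set_scope.
Local Open Scope ring_scope.

(** The system follows by reading the model at its lowest orders, first in the
    bulk, then in the layer, and by matching.

    In the bulk, order eps^-1 of the momentum balance is mu_0 grad phi_0 = 0, that
    is (phi_0^2 - 1) grad phi_0 = 0 because phi_0 does not vanish: the double-well
    energy of phi_0 is locally constant in space. So the trace of phi_0 on the
    interface is not 0 (phase_front_sign); the layer will show that it is +-1, and
    connectedness of Omega spreads this value over the whole subdomain
    (bulk_phase). Then the material coefficients are constant and the capillary
    force vanishes at order 0, which leaves the one-fluid equations
    (outer_momentum0, outer_ohm).

    In the layer everything is an ordinary differential equation in z at a fixed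
    point of the interface. Order eps^-1 of the incompressibility condition makes
    u_0 . n constant. As m_eps = m eps^2, order eps^-1 of the phase equation is
    (u_0 . n - V_Gamma) d_z phi_0 = m d_zz mu_0; integrated over the line it
    gives V_Gamma = u_0 . n and a constant mu_0 (inner_phase_balance). The equal
    area rule then yields the end values +-1 and mu_0 = 0 (equal_area), and the
    first integral of the profile equation yields
    d_z phi_0 = (1 - phi_0^2) / sqrt 2 with |phi_0| < 1 (transition_profile);
    in particular viscosity and conductivity are positive in the layer. Hence
    order eps^-2 of the momentum balance forces d_z u_0 = 0, order eps^-1 of Ohm's
    law d_z V_0 = 0, and order eps^-1 of charge conservation d_z J_0 . n = 0:
    these are the jump conditions for u, V and J.

    At order eps^-1 the momentum balance reads
    d_z (S_0 n) + mu_1 d_z phi_0 n = 0, where S_0 is the stress of the layer at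
    order 0. Its normal part contains d_z u_1, matched with the normal derivative
    of the outer velocity, and surface derivatives of u_0. The latter agree with
    those of the outer velocity, because a function that vanishes on the interface
    has no tangential derivative (tangential_derive). So S_0 tends to the outer
    stresses, and the jump of the stress is minus the integral of mu_1 d_z phi_0,
    which is lambda kappa (surface_tension). *)

Set Implicit Arguments.
Unset Strict Implicit.
Unset Printing Implicit Defensive.

(** * Calculus on the line *)

Section PointwiseRules.
Variables (R : realType) (V : normedModType R).
Implicit Types (f g : V -> R) (x v : V).

Lemma der_cst x v (k : R) : is_derive x v (fun=> k) 0.
Proof. exact: is_derive_cst. Qed.

Lemma der_D x v f g (a b : R) : is_derive x v f a -> is_derive x v g b ->
  is_derive x v (fun t => f t + g t) (a + b).
Proof. by move=> ? ?; exact: is_deriveD. Qed.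

Lemma der_B x v f g (a b : R) : is_derive x v f a -> is_derive x v g b ->
  is_derive x v (fun t => f t - g t) (a - b).
Proof. by move=> ? ?; exact: is_deriveB. Qed.

Lemma der_N x v f (a : R) : is_derive x v f a -> is_derive x v (fun t => - f t) (- a).
Proof. by move=> ?; exact: is_deriveN. Qed.

Lemma der_M x v f g (a b : R) : is_derive x v f a -> is_derive x v g b ->
  is_derive x v (fun t => f t * g t) (f x * b + g x * a).
Proof. by move=> ? ?; exact: is_deriveM. Qed.

Lemma der_X x v f (n : nat) (a : R) : is_derive x v f a ->
  is_derive x v (fun t => f t ^+ n) (n%:R * f x ^+ n.-1 * a).
Proof.
move=> ?; rewrite (_ : (fun t => _) = f ^+ n); first exact: is_deriveX.
by apply/funext=> t; rewrite exprfctE.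
Qed.

End PointwiseRules.

Lemma der_id (R : realType) (x : R) : is_derive x 1 (fun t : R => t) 1.
Proof. exact: is_derive_id. Qed.

Ltac der_step := first
  [ eassumption | match goal with H : _ |- _ => exact: H end
  | apply: der_cst | apply: der_id | apply: der_D | apply: der_B | apply: der_N | apply: der_M
  | apply: der_X].
Ltac der := eapply is_derive_eq; [ repeat der_step | rewrite /= ?/GRing.scale /=].

Section OneVariable.
Variable R : realType.
Implicit Types (f g y : R -> R).

Lemma is_derive1_continuous f (x l : R) : is_derive x 1 f l -> {for x, continuous f}.
Proof. by move=> [/derivable1_diffP/differentiable_continuous]. Qed.

Lemma is_derive1_within f (df : R -> R) (a b : R) :
  (forall x : R, is_derive x 1 f (df x)) -> {within `[a, b], continuous f}.
Proof.
move=> H; apply: continuous_subspaceT => x.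
exact: is_derive1_continuous (H x).
Qed.

Lemma is_derive0_cst f : (forall x : R, is_derive x 1 f 0) -> forall a b, f a = f b.
Proof. by move=> H a b; exact: is_derive_0_is_cst. Qed.

Lemma is_derive1_mvt f (df : R -> R) (a b : R) :
  (forall x : R, is_derive x 1 f (df x)) -> a < b ->
  exists2 c, a < c < b & f b - f a = df c * (b - a).
Proof.
move=> H ab; have [c|c] := MVT ab (fun x _ => H x); first exact: (is_derive1_within H).
by rewrite in_itv/= => cab E; exists c.
Qed.

Lemma is_derive1_nincr f (df : R -> R) (a b : R) :
  (forall x : R, is_derive x 1 f (df x)) ->
  (forall x, a < x < b -> df x <= 0) -> a <= b -> f b <= f a.
Proof.
move=> H df0; rewrite le_eqVlt => /predU1P[->//|ab].
have [c cab E] := is_derive1_mvt H ab.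
rewrite -subr_le0 E mulr_le0_ge0 ?df0//.
by rewrite subr_ge0 ltW.
Qed.

(** Gronwall: with K the maximum of a on the interval, y^2 exp(-2Kx) is
    nonincreasing and vanishes at z0. *)
Lemma linear_ode_unique_right y (a : R -> R) (z0 z : R) :
  (forall x : R, is_derive x 1 y (a x * y x)) -> continuous a ->
  y z0 = 0 -> z0 <= z -> y z = 0.
Proof.
move=> Hy ca y0 z0z.
have [|c _ cmax] := @EVT_max R a z0 z z0z; first exact: continuous_subspaceT.
pose K := a c.
pose g x := y x * y x * expR (- (2 * K) * x).
have Hg (x : R) : is_derive x 1 g (2 * (a x - K) * (y x * y x * expR (- (2 * K) * x))).
  have He : is_derive x 1 (fun x => expR (- (2 * K) * x)) (expR (- (2 * K) * x) * - (2 * K)).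
    apply: (@is_derive1_comp R expR (fun x => - (2 * K) * x) x).
    by der; ring.
  by der; ring.
have : g z <= g z0.
  apply: (is_derive1_nincr Hg) => // x /andP[/ltW x0 /ltW xz].
  rewrite mulr_le0_ge0 //; last by rewrite mulr_ge0 ?expR_ge0 // -expr2 sqr_ge0.
  by rewrite pmulr_rle0// subr_le0 cmax// in_itv/= x0 xz.
rewrite /g y0 !mul0r pmulr_lle0 ?expR_gt0 // -expr2 => ?.
by apply/eqP; rewrite -sqrf_eq0 eq_le sqr_ge0 andbT.
Qed.

Lemma der_reflect f (df : R) (x : R) : is_derive (- x) 1 f df ->
  is_derive x 1 (fun t => f (- t)) (- df).
Proof.
move=> H; have HN : is_derive x 1 (fun t : R => - t) (- 1) by exact: der_N (der_id x).
by have := @is_derive1_comp R f _ x df _ H HN; rewrite mulrN1.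
Qed.

Lemma linear_ode_unique y (a : R -> R) (z0 : R) :
  (forall x : R, is_derive x 1 y (a x * y x)) -> continuous a ->
  y z0 = 0 -> forall z, y z = 0.
Proof.
move=> Hy ca y0 z; have [|/ltW zz0] := leP z0 z.
  exact: linear_ode_unique_right Hy ca y0.
rewrite -[z]opprK.
apply: (@linear_ode_unique_right (fun t => y (- t)) (fun t => - a (- t)) (- z0)) => //.
- by move=> x; apply: (is_derive_eq (der_reflect (Hy _))); rewrite mulNr.
- by move=> x; apply: continuousN; apply: continuous_comp; [exact: continuousN|exact: ca].
- by rewrite opprK.
- by rewrite lerN2.
Qed.

#[global] Instance infty_proper (s : side) : ProperFilter (@infty R s).
Proof. by case: s => /=; exact: _. Qed.

(** Statements at -oo and at +oo are treated together by the substitution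
    r |-> sgn s * r, which carries both ends to +oo. *)
Lemma inftyP (s : side) (P : set R) :
  @infty R s P <-> \forall r \near +oo, P (sgn R s * r).
Proof.
case: s => /=.
  by split; apply: filterS => r; rewrite mul1r.
split.
  move=> [M [Mr H]]; exists (- M); split; rewrite ?realN// => x Mx.
  by apply: H; rewrite mulN1r ltrNl.
move=> [M [Mr H]]; exists (- M); split; rewrite ?realN// => x Mx.
by rewrite -[x]opprK -mulN1r; apply: H; rewrite ltrNr.
Qed.

Lemma cvg_infty_reflect (s : side) (f : R -> R) (l : R) :
  f @ @infty R s --> l <-> (fun r => f (sgn R s * r)) @ +oo --> l.
Proof.
split=> H A /H HA; first exact: (iffLR (inftyP s (f @^-1` A)) HA).
exact: (iffRL (inftyP s (f @^-1` A)) HA).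
Qed.

Lemma cvg_const_infty (s : side) (f : R -> R) (l c : R) :
  (forall z, f z = c) -> f @ @infty R s --> l -> l = c.
Proof.
move=> Hf fl; have fc : f @ @infty R s --> c.
  by rewrite (_ : f = cst c); [exact: cvg_cst|exact/funext].
exact: (cvg_unique _ fl fc).
Qed.

(** Matching enters through this lemma: a quantity conserved across the layer
    takes on the whole line its limit at either end. *)
Lemma first_integral_limit (s : side) f (z l : R) :
  (forall x : R, is_derive x 1 f 0) -> f @ @infty R s --> l -> f z = l.
Proof.
move=> Hf fl; apply/esym/(cvg_const_infty _ fl) => x.
exact: is_derive0_cst.
Qed.

Lemma cvg_exp (F : set_system R) (FF : Filter F) f (l : R) n :
  f @ F --> l -> (fun x => f x ^+ n) @ F --> l ^+ n.
Proof.
move=> fl; elim: n => [|n IH]; first by rewrite expr0; exact: cvg_cst.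
by under eq_fun do rewrite exprS; rewrite exprS; exact: cvgM.
Qed.

(** * The transition layer on the normal line *)

(** Leading order of the phase equation across the layer. Integrated once it
    reads (un - V) phi - m M' = const; both ends have M' = 0, so two distinct
    end values of phi force un = V, and then M' = 0 on the whole line. *)
Lemma inner_phase_balance (phi dphi M dM ddM : R -> R) (un V m : R) (a : side -> R) :
  (forall x : R, is_derive x 1 phi (dphi x)) ->
  (forall x : R, is_derive x 1 M (dM x)) ->
  (forall x : R, is_derive x 1 dM (ddM x)) ->
  (forall x, (un - V) * dphi x = m * ddM x) ->
  (forall s, phi @ @infty R s --> a s) ->
  (forall s, dM @ @infty R s --> (0 : R)) ->
  m != 0 -> a Plus != a Minus ->
  un = V /\ forall x x', M x = M x'.
Proof.
move=> Hphi HM HdM eq la lM m0 aa.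
pose g x := (un - V) * phi x - m * dM x.
have Hg (x : R) : is_derive x 1 g 0 by rewrite /g; der; have := eq x; lra.
have lg s : g @ @infty R s --> (un - V) * a s.
  rewrite -[X in _ --> X]subr0 -(mulr0 m).
  by apply: cvgB; apply: cvgM => //; exact: cvg_cst.
have E : (un - V) * a Plus = (un - V) * a Minus.
  by rewrite -(first_integral_limit 0 Hg (lg Plus)) -(first_integral_limit 0 Hg (lg Minus)).
have unV : un = V.
  move/eqP: E; rewrite -subr_eq0 -mulrBr mulf_eq0 !subr_eq0 (negbTE aa) orbF.
  by move/eqP.
split=> //; apply: is_derive0_cst => x.
suff <- : dM x = 0 by [].
have := first_integral_limit x Hg (lg Plus).
rewrite /g unV subrr !mul0r sub0r => /eqP.
by rewrite oppr_eq0 mulf_eq0 (negbTE m0) /= => /eqP.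
Qed.

(** Maxwell's equal area rule. The mechanical energy phi'^2 / 2 - W(phi) + K phi,
    with W the quartic double well, is conserved; so the line of slope K
    touches the graph of W at both end values, and the double tangent of a
    symmetric double well is horizontal. *)
Lemma equal_area (phi dphi : R -> R) (K : R) (a : side -> R) :
  (forall x : R, is_derive x 1 phi (dphi x)) ->
  (forall x : R, is_derive x 1 dphi (phi x ^+ 3 - phi x - K)) ->
  (forall s, phi @ @infty R s --> a s) ->
  (forall s, dphi @ @infty R s --> (0 : R)) ->
  (forall s, a s ^+ 3 - a s = K) ->
  (forall s, 0 < sgn R s * a s) ->
  K = 0 /\ forall s, a s = sgn R s.
Proof.
move=> Hphi Hdphi la ld aK asgn.
pose E x := dphi x ^+ 2 / 2 - (phi x ^+ 4 / 4 - phi x ^+ 2 / 2 - K * phi x).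
have HE (x : R) : is_derive x 1 E 0 by rewrite /E; der; lra.
have lE s : E @ @infty R s --> 0 ^+ 2 / 2 - (a s ^+ 4 / 4 - a s ^+ 2 / 2 - K * a s).
  apply: cvgB; first by apply: cvgM; [exact: cvg_exp|exact: cvg_cst].
  apply: cvgB; last by apply: cvgM => //; exact: cvg_cst.
  by apply: cvgB; (apply: cvgM; [exact: cvg_exp|exact: cvg_cst]).
have := first_integral_limit 0 HE (lE Plus).
rewrite (first_integral_limit 0 HE (lE Minus)).
have := aK Plus; have := aK Minus; have := asgn Plus; have := asgn Minus.
rewrite /= mul1r mulN1r oppr_gt0.
move=> {lE la aK asgn}; move Ep : (a Plus) => p; move Eq : (a Minus) => q q0 p0 Kq Kp W.
have E1 : p ^+ 2 + p * q + q ^+ 2 = 1.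
  apply/eqP; rewrite -subr_eq0.
  have : (p - q) * (p ^+ 2 + p * q + q ^+ 2 - 1) = 0 by nra.
  by move/eqP; rewrite mulf_eq0 => /orP[/eqP ?|//]; lra.
have E2 : (p + q) * (p - q) ^+ 3 = 0 by nra.
have pq : q = - p.
  move/eqP: E2; rewrite mulf_eq0 expf_eq0 /= => /orP[|] /eqP ?; lra.
have p1 : p = 1.
  have : (p - 1) * (p + 1) = 0 by subst q; nra.
  by move/eqP; rewrite mulf_eq0 => /orP[|] /eqP ?; lra.
split; first by rewrite -Kp p1; lra.
by case; rewrite /= ?Ep ?Eq ?pq p1.
Qed.

Lemma is_derive1_pos f (df : R -> R) :
  (forall x : R, is_derive x 1 f (df x)) -> (forall z, f z != 0) -> 0 < f 0 ->
  forall z, 0 < f z.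
Proof.
move=> Hf f0 f00 z; rewrite ltNge; apply/negP => fz.
have ivt a b : a <= b -> Num.min (f a) (f b) <= 0 <= Num.max (f a) (f b) -> False.
  move=> ab H; have [|c _ fc] := @IVT R f a b 0 ab _ H; first exact: is_derive1_within Hf.
  by move: (f0 c); rewrite fc eqxx.
have [z0|/ltW z0] := leP 0 z.
  by apply: (ivt 0 z z0); rewrite ge_min le_max fz (ltW f00) orbT.
by apply: (ivt z 0 z0); rewrite ge_min le_max fz (ltW f00) orbT.
Qed.

(** The energy phi'^2 - (1 - phi^2)^2 / 2 is conserved and vanishes at infinity.
    Each of its two factors w, v solves a linear first-order equation, so one of
    them vanishes identically. If it were v, then phi would decrease, against
    its end values; hence w = 0. Also 1 - phi^2 solves a linear equation and
    equals 1 at the centre, so it keeps its sign. (The profile is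
    tanh(z / sqrt 2), but only this first integral matters.) *)
Lemma transition_profile (phi dphi : R -> R) :
  (forall x : R, is_derive x 1 phi (dphi x)) ->
  (forall x : R, is_derive x 1 dphi (phi x ^+ 3 - phi x)) ->
  (forall s, phi @ @infty R s --> sgn R s) ->
  (forall s, dphi @ @infty R s --> (0 : R)) ->
  phi 0 = 0 ->
  forall z, dphi z = (1 - phi z ^+ 2) / Num.sqrt 2 /\ phi z ^+ 2 < 1.
Proof.
move=> Hphi Hdphi lphi ldphi phi0.
pose k : R := Num.sqrt 2.
have k0 : 0 < k by rewrite sqrtr_gt0.
have kk : k * k = 2 by rewrite -expr2 sqr_sqrtr.
have kV (x : R) : x / k = k / 2 * x.
  by apply: (mulIf (lt0r_neq0 k0)); rewrite mulfVK ?lt0r_neq0//; field: kk.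
pose h x := 1 - phi x ^+ 2.
pose w x := dphi x - k / 2 * h x.
pose v x := dphi x + k / 2 * h x.
have cphi : continuous phi by move=> x; exact: is_derive1_continuous (Hphi x).
have Hh (x : R) : is_derive x 1 h (- (2 * phi x * dphi x)) by rewrite /h; der; ring.
have Hw (x : R) : is_derive x 1 w (k * phi x * w x) by rewrite /w; der; rewrite /h; field: kk.
have Hv (x : R) : is_derive x 1 v (- k * phi x * v x) by rewrite /v; der; rewrite /h; field: kk.
have h0 : h 0 = 1 by rewrite /h phi0; ring.
have hpos (c : R) : (forall x, dphi x = c * h x) -> forall x, 0 < h x.
  move=> E; apply: (is_derive1_pos Hh); last by rewrite h0.
  move=> z; apply/eqP => hz.
  have : h 0 = 0; last by rewrite h0 => /eqP; rewrite oner_eq0.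
      apply: (@linear_ode_unique h (fun x => - (2 * c) * phi x) z) => // x.
    by apply: (is_derive_eq (Hh x)); rewrite E; ring.
  by apply: cvgM; [exact: cvg_cst|exact: cphi].
have energy : w 0 * v 0 = 0.
  have HE (x : R) : is_derive x 1 (fun x => w x * v x) 0 by der; ring.
  have lh s : h @ @infty R s --> (0 : R).
    rewrite (_ : 0 = 1 - sgn R s ^+ 2); last by case: s => /=; ring.
    by apply: cvgB; [exact: cvg_cst|exact: cvg_exp].
  have lw : w @ @infty R Plus --> 0 - k / 2 * 0.
    by apply: cvgB => //; apply: cvgM; [exact: cvg_cst|exact: lh].
  have lv : v @ @infty R Plus --> 0 + k / 2 * 0.
    by apply: cvgD => //; apply: cvgM; [exact: cvg_cst|exact: lh].
  by rewrite (first_integral_limit 0 HE (cvgM lw lv)); ring.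
have [w0|v0] : w 0 = 0 \/ v 0 = 0.
  by move/eqP: energy; rewrite mulf_eq0 => /orP[|] /eqP; [left|right].
  have wz z : w z = 0.
    apply: (@linear_ode_unique w (fun x => k * phi x) 0) => // x.
    by apply: cvgM; [exact: cvg_cst|exact: cphi].
  have E z : dphi z = k / 2 * h z by have := wz z; rewrite /w; lra.
  by move=> z; rewrite E -kV; split=> //; have := hpos _ E z; rewrite /h; lra.
exfalso.
have vz z : v z = 0.
  apply: (@linear_ode_unique v (fun x => - k * phi x) 0) => // x.
  by apply: cvgM; [exact: cvg_cst|exact: cphi].
have E z : dphi z = - (k / 2) * h z by have := vz z; rewrite /v; lra.
have hp := hpos _ E.
have : \forall r \near +oo, 0 < phi r.
  by have := lphi Plus => /= /cvgr_gt; apply; rewrite ltr01.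
move=> phipos; near (pinfty_nbhs R) => r.
have : phi r <= phi 0.
  apply: (is_derive1_nincr Hphi) => [x _|]; last by near: r; exact: nbhs_pinfty_ge.
  by rewrite E mulNr oppr_le0 mulr_ge0 ?divr_ge0 ?ltW.
by rewrite phi0 leNgt; apply/negP; rewrite negbK; near: r.
Unshelve. all: by end_near. Qed.

Lemma der_scale_arg f (df : R) (c x : R) : is_derive (c * x) 1 f df ->
  is_derive x 1 (fun t => f (c * t)) (c * df).
Proof.
move=> H; have HN : is_derive x 1 (fun t : R => c * t) c by der; ring.
by have := @is_derive1_comp R f _ x df _ H HN; rewrite mulrC.
Qed.

(** Since g' tends to 0, g grows at most linearly; since psi tends to 1 and
    k > 1, eventually h' <= - h, which makes x^2 h nonincreasing as soon as
    x >= 2. So g h = O(1 / x). *)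
Lemma sublinear_times_profile_right (g dg h psi : R -> R) (k : R) :
  1 < k ->
  (forall x : R, is_derive x 1 g (dg x)) ->
  (forall x : R, is_derive x 1 h (- k * psi x * h x)) ->
  (forall x, 0 < h x) -> psi @ +oo --> (1 : R) -> dg @ +oo --> (0 : R) ->
  (fun x => g x * h x) @ +oo --> (0 : R).
Proof.
move=> k1 Hg Hh h0 lpsi ldg.
have k0 : 0 < k by lra.
have kV : k^-1 < 1 by rewrite invf_lt1.
have [Z [Z2 HZ]] : exists Z : R, 2 < Z /\ forall x, Z < x -> 1 < k * psi x /\ `|dg x| < 1.
  have : \forall x \near +oo, k^-1 < psi x /\ `|dg x| < 1.
    apply: filterI; first by move/cvgr_gt : lpsi; apply.
    by move/cvgr0_norm_lt : ldg; apply.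
  move=> [M [_ HM]]; exists (Num.max 3 M); split; first by rewrite lt_max; apply/orP; left; lra.
  move=> x; rewrite gt_max => /andP[_ /HM[kx ?]]; split=> //.
  by rewrite -ltr_pdivrMl // mulr1.
pose C := Z ^+ 2 * h Z.
have hC x : Z <= x -> x ^+ 2 * h x <= C.
  move=> Zx; have Hx (t : R) : is_derive t 1 (fun t => t ^+ 2 * h t)
      (t * h t * (2 - t * (k * psi t))) by der; ring.
  apply: (is_derive1_nincr Hx) => // t /andP[Zt _].
  have [kt _] := HZ _ Zt; rewrite mulr_ge0_le0 //.
    by rewrite mulr_ge0 // ?ltW //; lra.
  by nra.
pose B := `|g Z| + 1.
have gB x : Z < x -> `|g x| <= B * x.
  move=> Zx; have [c /andP[Zc _] E] := is_derive1_mvt Hg Zx.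
  have [_ dc] := HZ _ Zc.
  have -> : g x = g Z + dg c * (x - Z) by rewrite -E; ring.
  apply: (le_trans (ler_normD _ _)); rewrite normrM.
  have -> : `|x - Z| = x - Z by rewrite ger0_norm // subr_ge0 ltW.
  have d0 : 0 <= (1 - `|dg c|) * (x - Z) by rewrite mulr_ge0 ?subr_ge0 ?ltW.
  have x1 : 0 <= `|g Z| * (x - 1) by rewrite mulr_ge0 // subr_ge0 ltW //; lra.
  by rewrite /B; lra.
apply/cvgr0Pnorm_lt => e e0; near=> x.
have Zx : Z < x by near: x; apply: nbhs_pinfty_gt; exact: num_real.
rewrite normrM (gtr0_norm (h0 _)).
have x0 : 0 < x by lra.
have xe : B * C / e < x by near: x; apply: nbhs_pinfty_gt; exact: num_real.
rewrite -(ltr_pM2r x0); apply: (@le_lt_trans _ _ (B * (x ^+ 2 * h x))).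
  rewrite (_ : B * _ = B * x * h x * x); last by ring.
  by rewrite ler_pM2r // ler_pM2r // gB.
apply: (@le_lt_trans _ _ (B * C)).
  by rewrite ler_wpM2l ?addr_ge0 // hC // ltW.
by rewrite -ltr_pdivrMl // mulrC.
Unshelve. all: by end_near. Qed.

Lemma sublinear_times_profile (s : side) (g dg phi h : R -> R) (k : R) :
  1 < k ->
  (forall x : R, is_derive x 1 g (dg x)) ->
  (forall x : R, is_derive x 1 h (- k * phi x * h x)) ->
  (forall x, 0 < h x) -> phi @ @infty R s --> sgn R s -> dg @ @infty R s --> (0 : R) ->
  (fun x => g x * h x) @ @infty R s --> (0 : R).
Proof.
move=> k1 Hg Hh h0 /cvg_infty_reflect lphi /cvg_infty_reflect ldg.
have ss : sgn R s * sgn R s = 1 by case: s {lphi ldg} => /=; ring.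
apply/cvg_infty_reflect.
apply: (@sublinear_times_profile_right (fun t => g (sgn R s * t))
  (fun t => sgn R s * dg (sgn R s * t)) (fun t => h (sgn R s * t))
  (fun t => sgn R s * phi (sgn R s * t)) k k1) => //.
- by move=> x; exact: der_scale_arg.
- by move=> x; apply: (is_derive_eq (der_scale_arg (Hh _))); ring.
- by rewrite -[X in _ --> X]ss; apply: cvgM => //; exact: cvg_cst.
- by rewrite -[X in _ --> X](mulr0 (sgn R s)); apply: cvgM => //; exact: cvg_cst.
Qed.

(** The integral of mu1 phi' across the layer. The terms of mu1 that contain
    phi1 contribute the derivative of - phi1' phi' + phi1 phi'', because phi' is
    in the kernel of the linearized operator; what remains is kap phi'^2, and
    phi' = (1 - phi^2) / sqrt 2 turns its integral into that of a polynomial in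
    phi, equal to 2 sqrt 2 / 3. The factor of lam in mu1 normalizes the result
    to lam * kap. *)
Lemma surface_tension (phi dphi phi1 dphi1 ddphi1 S : R -> R)
    (lam kap nrm : R) (l : side -> R) :
  let mu1 z := 3 * lam / (2 * Num.sqrt 2) *
    (- ddphi1 z + kap * dphi z + (3 * phi z ^+ 2 - 1) * phi1 z) in
  (forall x : R, is_derive x 1 phi (dphi x)) ->
  (forall x : R, is_derive x 1 dphi (phi x ^+ 3 - phi x)) ->
  (forall z, dphi z = (1 - phi z ^+ 2) / Num.sqrt 2 /\ phi z ^+ 2 < 1) ->
  (forall s, phi @ @infty R s --> sgn R s) ->
  (forall s, dphi @ @infty R s --> (0 : R)) ->
  (forall x : R, is_derive x 1 phi1 (dphi1 x)) ->
  (forall x : R, is_derive x 1 dphi1 (ddphi1 x)) ->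
  (forall s, dphi1 @ @infty R s --> (0 : R)) ->
  (forall x : R, is_derive x 1 S (- (nrm * mu1 x * dphi x))) ->
  (forall s, S @ @infty R s --> l s) ->
  l Plus - l Minus = - (lam * kap * nrm).
Proof.
move=> mu1 Hphi Hdphi prof lphi ldphi Hphi1 Hdphi1 ldphi1 HS lS.
pose k : R := Num.sqrt 2.
have k0 : 0 < k by rewrite sqrtr_gt0.
have k1 : 1 < k by rewrite -[X in X < _]sqrtr1 ltr_sqrt ?ltr1n.
have kk : k * k = 2 by rewrite -expr2 sqr_sqrtr.
have kV (x : R) : x / k = k / 2 * x.
  by apply: (mulIf (lt0r_neq0 k0)); rewrite mulfVK ?lt0r_neq0//; field: kk.
have dphiE z : dphi z = k / 2 * (1 - phi z ^+ 2) by rewrite -kV; case: (prof z).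
pose c := 3 * lam * k / 4.
have cE : 3 * lam / (2 * k) = c.
  by rewrite /c; apply: (mulIf (lt0r_neq0 k0)); rewrite invfM mulrA mulfVK ?lt0r_neq0//; field: kk.
pose h x := 1 - phi x ^+ 2.
(* Antiderivative of mu1 phi', with phi'' = - h phi substituted. *)
pose Q x := c * (- dphi1 x * dphi x - phi1 x * h x * phi x
                 + kap * (k / 2) * (phi x - phi x ^+ 3 / 3)).
have HQ (x : R) : is_derive x 1 Q (mu1 x * dphi x).
  by rewrite /Q /h; der; rewrite /mu1 cE dphiE; field: kk.
have Hh (x : R) : is_derive x 1 h (- k * phi x * h x).
  by rewrite /h; der; rewrite dphiE; field.
have lh s : (fun x => phi1 x * h x) @ @infty R s --> (0 : R).
  apply: (sublinear_times_profile k1 Hphi1 Hh) => // x.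
  by rewrite subr_gt0; case: (prof x).
have lQ s : Q @ @infty R s --> c * (- 0 * 0 - 0 * sgn R s
    + kap * (k / 2) * (sgn R s - sgn R s ^+ 3 / 3)).
  apply: cvgM; first exact: cvg_cst.
  apply: cvgD.
    by apply: cvgB; apply: cvgM => //; exact: cvgN.
  apply: cvgM; first exact: cvg_cst.
  by apply: cvgB => //; apply: cvgM; [exact: cvg_exp|exact: cvg_cst].
have HC (x : R) : is_derive x 1 (fun x => S x + nrm * Q x) 0 by der; ring.
have lC s : (fun x => S x + nrm * Q x) @ @infty R s --> l s + nrm * (c * (- 0 * 0
    - 0 * sgn R s + kap * (k / 2) * (sgn R s - sgn R s ^+ 3 / 3))).
  by apply: cvgD => //; apply: cvgM => //; exact: cvg_cst.
have := first_integral_limit 0 HC (lC Plus).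
rewrite (first_integral_limit 0 HC (lC Minus)) /= /c => E.
apply/eqP; rewrite -subr_eq0; apply/eqP; move/eqP: E; rewrite -subr_eq0 => /eqP E.
by rewrite -[RHS]oppr0 -[in RHS]E; field: kk.
Qed.

End OneVariable.

(** * Leading orders of formal Laurent series *)

Section FormalSeries.
Variables (R : realType) (E : Type).
Implicit Types (a b : series_on R E) (p r k : int) (w : E).

(** Only the two lowest orders of a series are ever used: the products and
    derivatives below are computed at the order where they start and at the next
    one. *)
Definition starts_at p a := forall k w, k < p -> a k w = 0.

Lemma starts_at_weaken p r a : starts_at p a -> r <= p -> starts_at r a.
Proof. by move=> Ha rp k w kr; apply: Ha; exact: lt_le_trans rp. Qed.

Lemma starts_at_power_series p (c : nat -> E -> R^o) : starts_at p (power_series p c).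
Proof.
move=> k w kp; rewrite /power_series; move: kp; rewrite -subr_lt0.
by case: (k - p).
Qed.

Lemma starts_at_add p a b : starts_at p a -> starts_at p b -> starts_at p (a + b).
Proof. by move=> Ha Hb k w kp; rewrite !fctE Ha // Hb // addr0. Qed.

Lemma starts_at_opp p a : starts_at p a -> starts_at p (- a).
Proof. by move=> Ha k w kp; rewrite !fctE Ha // oppr0. Qed.

Lemma starts_at_scale p (c : R) a : starts_at p a -> starts_at p (c *: a).
Proof. by move=> Ha k w kp; rewrite !fctE Ha // scaler0. Qed.

Lemma series_sumE (I : Type) (s : seq I) (f : I -> series_on R E) k w :
  (\sum_(i <- s) f i) k w = \sum_(i <- s) f i k w.
Proof. by rewrite !fct_sumE. Qed.

Lemma starts_at_eps p n a : starts_at p a -> starts_at (p + n) (seps n a).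
Proof. by move=> Ha k w kp; apply: Ha; rewrite ltrBlDr. Qed.

Lemma starts_at_one : starts_at 0 (@sone R E).
Proof. by move=> k w k0; rewrite /sone; move: k0; case: k. Qed.

Lemma smul_finite a b k w (s : seq int) : uniq s ->
  (forall i, i \notin s -> a i w * b (k - i) w = 0) ->
  smul a b k w = \sum_(i <- s) a i w * b (k - i) w.
Proof.
move=> us H; rewrite /smul (fsbigE s) //; last by move=> i _; exact: H.
apply: eq_bigl => i; exact: in_setT.
Qed.

Lemma starts_at_mul p r a b : starts_at p a -> starts_at r b ->
  starts_at (p + r) (smul a b).
Proof.
move=> Ha Hb k w kp; rewrite (@smul_finite _ _ _ _ [::]) ?big_nil // => i _.
have [ip|pi] := ltP i p; first by rewrite Ha ?mul0r.
by rewrite Hb ?mulr0 //; lia.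
Qed.

Lemma smul_lead p r a b w : starts_at p a -> starts_at r b ->
  smul a b (p + r) w = a p w * b r w.
Proof.
move=> Ha Hb; rewrite (@smul_finite _ _ _ _ [:: p]) //.
  by rewrite big_seq1 addrAC subrr add0r.
move=> i; rewrite inE => ip.
have [ip'|pi] := ltP i p; first by rewrite Ha ?mul0r.
by rewrite Hb ?mulr0 //; lia.
Qed.

Lemma smul_next p r a b w : starts_at p a -> starts_at r b ->
  smul a b (p + r + 1) w = a p w * b (r + 1) w + a (p + 1) w * b r w.
Proof.
move=> Ha Hb; rewrite (@smul_finite _ _ _ _ [:: p; p + 1]) //.
- have -> : r + 1 = p + r + 1 - p by lia.
  by rewrite big_cons big_seq1; have -> : p + r + 1 - (p + 1) = r by lia.
- by rewrite /= inE andbT; lia.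
move=> i; rewrite !inE => ip.
have [ip'|pi] := ltP i p; first by rewrite Ha ?mul0r.
by rewrite Hb ?mulr0 //; lia.
Qed.

End FormalSeries.

Section Derivations.
Variable (R : realType).

Lemma derive_eq0 (E : normedModType R) (v w : E) (f : E -> R^o) :
  (forall x, f x = 0) -> 'D_v f w = 0.
Proof. by move=> /funext ->; exact: derive_cst. Qed.

Lemma starts_at_derive (E : normedModType R) (v : E) p (a : series_on R E) :
  starts_at p a -> starts_at p (fun k => 'D_v (a k)).
Proof. by move=> Ha k w kp; apply: derive_eq0 => x; exact: Ha. Qed.

Variable d : spacetime R -> R^o.

Lemma taylor_normal_zero j w (f : R -> spacetime R -> R^o) :
  (forall z q, f z q = 0) -> taylor_normal d f j w = 0.
Proof.
move=> f0; case: w => q z; rewrite /taylor_normal.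
suff -> : (fun r : R => f z (q.1, q.2 + r *: n_Gamma d q)) = cst 0.
  suff -> : derive1n j (cst 0 : R -> R^o) = cst 0 by rewrite mulr0.
  elim: j => [//|j IH]; rewrite derive1nS IH.
  by apply/funext => x; exact: derive1_cst.
by apply/funext => r; rewrite f0.
Qed.

Lemma taylor_normal0 w (f : R -> spacetime R -> R^o) :
  taylor_normal d f 0 w = f w.2 w.1.
Proof.
case: w => [[t x] z]; rewrite /taylor_normal derive1n0 /= scale0r addr0.
by rewrite expr0 fact0 divr1 mul1r.
Qed.

(** At the two lowest orders the Taylor expansion along the normal contributes
    its constant term only. *)
Lemma inner_taylor_finite (v : spacetime R) (p k : int) (a : series_on R (stretched R)) w :
  starts_at p a -> k <= p ->
  \sum_(j \in [set: nat])
    taylor_normal d (fun z => 'D_v (normal_ext d (a (k - j%:Z)) z)) j w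
  = 'D_v (normal_ext d (a k) w.2) w.1.
Proof.
move=> Ha kp; rewrite (fsbigE [:: 0%N]) //.
  by rewrite big_cons big_nil in_setT taylor_normal0 subr0; exact: addr0.
move=> j _; rewrite inE => j0; apply: taylor_normal_zero => z q.
by apply: derive_eq0 => x; apply: Ha; lia.
Qed.

(** With inner_deriv_lead below: the rules d_v = eps^-1 (D_v d) d_z + tangential
    part + O(eps), read off order by order. *)
Lemma inner_deriv_next v p (a : series_on R (stretched R)) w : starts_at p a ->
  inner_deriv d v a p w = 'D_v d w.1 * 'D_dir_z (a (p + 1)) w
    + 'D_v (normal_ext d (a p) w.2) w.1.
Proof. by move=> Ha; rewrite /inner_deriv (inner_taylor_finite _ _ Ha). Qed.

Lemma inner_deriv_lead v p (a : series_on R (stretched R)) w : starts_at p a ->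
  inner_deriv d v a (p - 1) w = 'D_v d w.1 * 'D_dir_z (a p) w.
Proof.
move=> Ha; rewrite /inner_deriv (inner_taylor_finite _ _ Ha); last by lia.
rewrite subrK [X in _ + X]derive_eq0 ?addr0 // => x.
by apply: Ha; lia.
Qed.

Lemma starts_at_inner_deriv v p (a : series_on R (stretched R)) :
  starts_at p a -> starts_at (p - 1) (inner_deriv d v a).
Proof.
move=> Ha k w kp.
have -> : inner_deriv d v a k w = inner_deriv d v a (k + 1 - 1) w by rewrite addrK.
rewrite inner_deriv_lead; last by apply: starts_at_weaken Ha _; lia.
by rewrite [X in _ * X]derive_eq0 ?mulr0 // => x; apply: Ha; lia.
Qed.

End Derivations.

(** * Derivatives along lines *)

Section DirectionalDerivatives.
Variables (R : realType) (E : normedModType R).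
Implicit Types (f g : E -> R^o) (p v : E) (A : set E).

Lemma smooth_near_differentiable A f p : smooth_near A f -> A p -> differentiable f p.
Proof. by move=> [U [oU AU sf]] Ap; have [+ _] := sf 1%N; apply; exact: AU. Qed.

Lemma smooth_near_nbhs A f p : smooth_near A f -> A p ->
  \forall q \near p, differentiable f q.
Proof.
move=> [U [oU AU sf]] Ap; have [df _] := sf 1%N.
by have := open_nbhs_nbhs (conj oU (AU _ Ap)); apply: filterS => q; exact: df.
Qed.

Lemma smooth_near_derive A f v : smooth_near A f -> smooth_near A ('D_v f).
Proof.
by move=> [U [oU AU sf]]; exists U; split=> // k; have [_] := sf k.+1; apply.
Qed.

Lemma smooth_near_continuous A f p : smooth_near A f -> A p -> {for p, continuous f}.
Proof. by move=> sf Ap; exact/differentiable_continuous/(smooth_near_differentiable sf). Qed.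

Lemma line_quotient f p v (r : R) :
  (fun h => h^-1 *: ((f \o shift (p + r *: v)) (h *: v) - f (p + r *: v))) =
  (fun h => h^-1 *: (((fun t : R => f (p + t *: v)) \o shift r) (h *: 1)
                     - f (p + r *: v))).
Proof. by apply/funext => h; rewrite /= [h *: 1]mulr1 scalerDl addrCA. Qed.

Lemma derive_line f p v (r : R) :
  'D_v f (p + r *: v) = 'D_1 (fun t : R => f (p + t *: v)) r.
Proof. by rewrite /derive line_quotient. Qed.

Lemma is_derive_line f p v (r : R) : derivable f (p + r *: v) v ->
  is_derive r 1 (fun t : R => f (p + t *: v)) ('D_v f (p + r *: v)).
Proof.
move=> H; split; last by rewrite derive_line.
by rewrite /derivable -line_quotient; exact: H.
Qed.

(** A directional derivative sees the function along one line only. This is what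
    allows spatial differentiation of identities that hold on the bulk, which at
    t = 0 is not a neighbourhood of its points. *)
Lemma near_line_derive f g p v :
  (\forall h \near (0 : R), f (p + h *: v) = g (p + h *: v)) -> 'D_v f p = 'D_v g p.
Proof.
move=> H; have p0 : p = p + 0 *: v by rewrite scale0r addr0.
by rewrite [in LHS]p0 [in RHS]p0 !derive_line; exact: near_eq_derive.
Qed.

Lemma differentiable_small_o f p (e : R) : differentiable f p -> 0 < e ->
  \forall h \near (0 : E), `|f (p + h) - f p - 'd f p h| <= e * `|h|.
Proof.
move=> df e0; have /diff_locally/eqaddoP/(_ e e0) := df.
by apply: filterS => h; rewrite !fctE /= opprD addrA [h + p]addrC.
Qed.

End DirectionalDerivatives.

(** * Tangential derivatives on the interface *)

Section Space.
Variable R : realType.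
Implicit Types (q : spacetime R) (f g : spacetime R -> R^o) (w : 'rV[R]_3).

Definition spatial w : spacetime R := (0, w).

Lemma spatialE w : spatial w = \sum_i w 0 i *: dir_x i.
Proof.
apply: injective_projections => /=.
  rewrite (big_morph fst (id1 := 0) (op1 := +%R)) //.
  by rewrite big1 // => i _; rewrite /= scaler0.
rewrite (big_morph snd (id1 := 0) (op1 := +%R)) //.
by rewrite {1}(row_sum_delta w).
Qed.

Lemma derive_spatial f q w : differentiable f q ->
  'D_(spatial w) f q = dot (sgrad f q) w.
Proof.
move=> df; rewrite deriveE // spatialE linear_sum /dot.
by apply: eq_bigr => i _; rewrite linearZ /= -deriveE // mxE mulrC.
Qed.

Lemma dotBr (u v w : 'rV[R]_3) : dot u (v - w) = dot u v - dot u w.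
Proof. by rewrite /dot -sumrB; apply: eq_bigr => i _; rewrite !mxE mulrBr. Qed.

Lemma dotZr (u v : 'rV[R]_3) a : dot u (a *: v) = a * dot u v.
Proof. by rewrite /dot mulr_sumr; apply: eq_bigr => i _; rewrite !mxE mulrCA. Qed.

Lemma dot_delta (v : 'rV[R]_3) i : dot v (delta_mx 0 i) = v 0 i.
Proof.
rewrite /dot (bigD1 i) //= mxE !eqxx mulr1 big1 ?addr0 // => k ki.
by rewrite mxE eqxx (negbTE ki) mulr0.
Qed.

End Space.

Section RealEstimates.
Variable R : realType.
Implicit Types x b e t r : R.

(** With slope_estimate and sign_change below, the scalar part of the proof of
    tangential_derive. *)
Lemma eq0_of_small_multiples x b :
  (forall e, 0 < e -> e <= 1 -> `|x| <= e * (`|b| + 1)) -> x = 0.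
Proof.
move=> main; apply/eqP/contraT; rewrite -normr_gt0 => x0.
have b1 : 0 < `|b| + 1 by rewrite ltr_wpDl.
pose e := Num.min 1 (`|x| / (2 * (`|b| + 1))).
have e0 : 0 < e by rewrite lt_min ltr01 divr_gt0 // mulr_gt0.
have e1 : e <= 1 by rewrite ge_min lexx.
have := main e e0 e1.
have : e <= `|x| / (2 * (`|b| + 1)) by rewrite ge_min lexx orbT.
rewrite ler_pdivlMr ?mulr_gt0 // => h1 h2; lra.
Qed.

Lemma slope_estimate t e x b r : 0 < t -> 0 < e -> `|r| <= e * t ->
  `|t * x + r * b| <= e * t / 2 -> `|x| <= e * (`|b| + 1).
Proof.
move=> t0 e0 re h.
have : `|t * x| <= e * t / 2 + `|r * b|.
  rewrite -[t * x](addrK (r * b)); apply: (le_trans (ler_normB _ _)).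
  by rewrite lerD2r.
rewrite !normrM (gtr0_norm t0) => {}h.
have hb : `|r| * `|b| <= e * t * `|b| by rewrite ler_wpM2r.
rewrite -(ler_pM2l t0).
have et := mulr_gt0 e0 t0; lra.
Qed.

Lemma sign_change a (yl yr : R) : 0 < a -> `|yr - a| <= a / 2 -> `|yl - - a| <= a / 2 ->
  Num.min yl yr <= 0 <= Num.max yl yr.
Proof.
move=> a0; rewrite !ler_norml => /andP[h1 h2] /andP[h3 h4].
by rewrite ge_min le_max; apply/andP; split; apply/orP; [left|right]; lra.
Qed.

End RealEstimates.

Section Interface.
Variables (R : realType) (Omega : set 'rV[R]_3) (T : R) (d : spacetime R -> R^o).
Hypothesis Hd : evolving_interface Omega T d.
Implicit Types (q : spacetime R) (f g : spacetime R -> R^o) (w : 'rV[R]_3).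

Local Notation front := (front Omega T d).
Local Notation bulk := (bulk Omega T d).
Local Notation n_ q := (n_Gamma d q).

Lemma normal_unit q : front q -> dot (n_ q) (n_ q) = 1.
Proof.
move=> /(ei_unit Hd) /(congr1 (fun x => x ^+ 2)).
by rewrite /elen expr1n sqr_sqrtr // sumr_ge0 // => i _; exact: sqr_ge0.
Qed.

Lemma d_differentiable q : front q -> differentiable d q.
Proof. exact: smooth_near_differentiable (ei_smooth Hd). Qed.

Lemma derive_d_spatial q w : front q -> 'D_(spatial w) d q = dot (n_ q) w.
Proof. by move=> Fq; rewrite derive_spatial //; exact: d_differentiable. Qed.

Lemma omega_nbhs (q : spacetime R) : Omega q.2 -> \forall v \near (0 : spacetime R), Omega (q + v).2.
Proof.
move=> Oq.
have : \forall q' \near q, Omega q'.2.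
  have : \forall x \near q.2, Omega x by exact: open_nbhs_nbhs (conj (ei_open Hd) Oq).
  exact: cvg_snd.
by move/nbhs0P.
Qed.

Lemma frontE q : front q <-> [/\ 0 <= q.1 < T, Omega q.2 & d q = 0].
Proof. by case: q => t x; split=> [[? []]|[]]. Qed.

Lemma bulkE s q : bulk s q <-> [/\ 0 <= q.1 < T, Omega q.2 & 0 < sgn R s * d q].
Proof. by case: q => t x; split=> [[? []]|[]]. Qed.

Lemma nbhs0_norm (P : set (spacetime R)) : (\forall v \near (0 : spacetime R), P v) ->
  exists2 rho : R, 0 < rho & forall v, `|v| < rho -> P v.
Proof.
move=> /nbhs_normP[rho rho0 H]; exists rho => // v vr.
by apply: H; rewrite /= sub0r normrN.
Qed.

(** A function that vanishes on the interface has no tangential derivative.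
    Starting at q and moving by t w, the intermediate value theorem finds an
    interface point within e t along the normal, since d grows there with unit
    slope and varies only by o(t) in the direction w. Comparing the value 0 of f
    at that point with its linearization and letting e tend to 0 gives the
    claim; no parametrization of the interface is needed. *)
Lemma tangential_derive f q w : front q -> differentiable f q ->
  (forall q', front q' -> f q' = 0) -> dot (n_ q) w = 0 -> 'D_(spatial w) f q = 0.
Proof.
move=> Fq df f0 wn; have [qT Oq dq] := iffLR (frontE q) Fq.
have ddq := d_differentiable Fq.
pose N := spatial (n_ q); pose W := spatial w.
pose C := `|W| + `|N| + 1.
have C0 : 0 < C by rewrite /C; have := normr_ge0 W; have := normr_ge0 N; lra.
apply: (@eq0_of_small_multiples _ _ ('D_N f q)) => e e0 e1.
(* The points t w + r n with |r| <= e t have norm at most t C, so that the error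
   of linearization is at most e t / 2, half of the normal displacement. *)
pose eps := e / (2 * C).
have eps0 : 0 < eps by rewrite divr_gt0 // mulr_gt0.
have epsC t : eps * (t * C) = e * t / 2 by rewrite /eps; field; rewrite lt0r_neq0.
have [rho rho0 H] : exists2 rho : R, 0 < rho & forall v : spacetime R, `|v| < rho ->
    [/\ Omega (q + v).2, differentiable d (q + v),
        `|f (q + v) - f q - 'd f q v| <= eps * `|v| &
        `|d (q + v) - d q - 'd d q v| <= eps * `|v|].
  apply: nbhs0_norm.
  have h1 := omega_nbhs Oq.
  have h2 := iffLR (nbhs0P (fun y => differentiable d y) q) (smooth_near_nbhs (ei_smooth Hd) Fq).
  have h3 := differentiable_small_o df eps0.
  have h4 := differentiable_small_o ddq eps0.
  apply: filterS (filterI (filterI h1 h2) (filterI h3 h4)) => v [[? ?] [? ?]].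
  exact: And4.
have [t t0 tC] : exists2 t, 0 < t & t * C < rho.
  exists (rho / (2 * C)); first by rewrite divr_gt0 // mulr_gt0.
  have -> : rho / (2 * C) * C = rho / 2 by field; rewrite lt0r_neq0.
  by rewrite ltr_pdivrMr // mulr_natr mulr2n ltrDl.
pose v r := t *: W + r *: N.
have nv r : `|r| <= e * t -> `|v r| <= t * C.
  move=> re; apply: (le_trans (ler_normD _ _)); rewrite !normrZ (gtr0_norm t0).
  have : `|r| * `|N| <= t * `|N|.
    by rewrite ler_wpM2r //; apply: (le_trans re); rewrite ler_piMl // ltW.
  by rewrite /C; lra.
have Hv r : `|r| <= e * t -> `|v r| < rho by move=> /nv; lra.
have dv r : 'd d q (v r) = r.
  rewrite /v linearD !linearZ /= -!deriveE // !derive_d_spatial // wn normal_unit //.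
  by rewrite scaler0 add0r [_ *: _]mulr1.
have fv r : 'd f q (v r) = t * 'D_W f q + r * 'D_N f q.
  by rewrite /v linearD !linearZ /= -!deriveE.
have dline r : q + v r = (q + t *: W) + r *: N by rewrite /v addrA.
have [| | |r0 r0_in dr0] := @IVT R (fun r => d (q + v r)) (- (e * t)) (e * t) 0.
- by rewrite lerNl; have := mulr_gt0 e0 t0; lra.
- apply: continuous_in_subspaceT => r; rewrite inE /= in_itv /= -ler_norml => /Hv /H[_ ddr _ _].
  under [X in continuous_at _ X]eq_fun do rewrite dline.
  apply: is_derive1_continuous; apply: is_derive_line; rewrite -dline.
  exact: diff_derivable.
- have et := mulr_gt0 e0 t0.
  have bnd r : `|r| <= e * t -> `|d (q + v r) - r| <= e * t / 2.
    move=> re; have [_ _ _] := H _ (Hv _ re); rewrite dv dq subr0 => /le_trans; apply.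
    by rewrite -epsC ler_wpM2l ?(ltW eps0) // nv.
  have h1 : `|e * t| <= e * t by rewrite gtr0_norm.
  have h2 : `|- (e * t)| <= e * t by rewrite normrN.
  exact: (sign_change et (bnd _ h1) (bnd _ h2)).
have r0e : `|r0| <= e * t by move: r0_in; rewrite in_itv /= -ler_norml.
have [Or _ fr _] := H _ (Hv _ r0e).
have Fr : front (q + v r0).
  apply/frontE; split=> //.
  by rewrite /v /= !scaler0 !addr0.
move: fr; rewrite (f0 _ Fr) (f0 _ Fq) fv subrr sub0r normrN => fr.
apply: (slope_estimate t0 e0 r0e (b := 'D_N f q)).
by apply: (le_trans fr); rewrite -epsC ler_wpM2l ?(ltW eps0) // nv.
Qed.

End Interface.

Section NormalProjection.
Variables (R : realType) (Omega : set 'rV[R]_3) (T : R) (d : spacetime R -> R^o).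
Hypothesis Hd : evolving_interface Omega T d.
Implicit Types (q : spacetime R) (f g : spacetime R -> R^o) (w : 'rV[R]_3).

Local Notation front := (front Omega T d).
Local Notation bulk := (bulk Omega T d).
Local Notation n_ q := (n_Gamma d q).

Definition tangent q w : 'rV[R]_3 := w - dot (n_ q) w *: n_ q.

Lemma dot_tangent q w : front q -> dot (n_ q) (tangent q w) = 0.
Proof.
move=> /(normal_unit Hd) nn; rewrite /tangent dotBr dotZr nn mulr1.
exact: subrr.
Qed.

Lemma footE q : foot d q = q - \sum_i (d q * 'D_(dir_x i) d q) *: dir_x i.
Proof.
have -> : \sum_i (d q * 'D_(dir_x i) d q) *: dir_x i = spatial (d q *: sgrad d q).
  by rewrite spatialE; apply: eq_bigr => i _; rewrite !mxE.
by case: q => t x; rewrite /foot /spatial /=; congr (_, _); rewrite subr0.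
Qed.

Lemma foot_front q : front q -> foot d q = q.
Proof.
by move=> /frontE[_ _ dq]; case: q dq => t x dq; rewrite /foot /= dq scale0r subr0.
Qed.

(** As d = 0 at q, differentiating d grad d differentiates the factor d only:
    the derivative of the projection to the interface is the tangential
    projection. *)
Lemma is_derive_foot q w : front q ->
  differentiable (foot d) q /\ 'D_(spatial w) (foot d) q = spatial (tangent q w).
Proof.
move=> Fq; have ddq := d_differentiable Hd Fq.
have dDq i : differentiable ('D_(dir_x i) d) q.
  exact: smooth_near_differentiable (smooth_near_derive _ (ei_smooth Hd)) Fq.
have -> : foot d = id - \sum_i (fun q => (d q * 'D_(dir_x i) d q) *: dir_x i).
  by apply/funext => q'; rewrite footE !fctE fct_sumE.
have dg i : differentiable (fun q => (d q * 'D_(dir_x i) d q) *: (dir_x i : spacetime R)) q.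
  by apply: differentiableZl; exact: differentiableM.
have dS : differentiable (\sum_i (fun q => (d q * 'D_(dir_x i) d q) *: (dir_x i : spacetime R))) q.
  exact: differentiable_sum.
split; first exact: differentiableB.
rewrite deriveB; [|exact: derivable_id|exact: diff_derivable].
rewrite derive_id derive_sum; last by move=> i; exact: diff_derivable.
transitivity (spatial w - spatial (dot (n_ q) w *: n_ q)); last first.
  by rewrite /spatial /tangent; congr (_, _); rewrite /= subr0.
congr (_ - _); rewrite (spatialE (_ *: _)); apply: eq_bigr => i _.
rewrite deriveE // diffZl; last exact: differentiableM.
congr (_ *: _); rewrite -deriveE; last exact: differentiableM.
rewrite deriveM; [|exact: diff_derivable|exact: diff_derivable].
have [_ _ ->] := iffLR (frontE _ _ _ _) Fq.
by rewrite scale0r add0r (derive_d_spatial Hd w) // !mxE /GRing.scale /= mulrC.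
Qed.

(** Differentiating an extension that is constant along normals gives the surface
    gradient. *)
Lemma derive_normal_ext (X : stretched R -> R^o) z q w : front q ->
  differentiable X (q, z) ->
  'D_(spatial w) (normal_ext d X z) q = 'D_(spatial (tangent q w)) (fun q' => X (q', z)) q.
Proof.
move=> Fq dX; have [df Df] := is_derive_foot w Fq.
have dXz : differentiable (fun q' : spacetime R => X (q', z)) q.
  apply: (@differentiable_comp _ _ _ _ (fun q' : spacetime R => (q', z) : stretched R) X) => //.
rewrite (_ : normal_ext d X z = (fun q' => X (q', z)) \o foot d) //.
have dXf : differentiable (fun q' : spacetime R => X (q', z)) (foot d q) by rewrite foot_front.
rewrite deriveE; last exact: differentiable_comp.
by rewrite diff_comp //= -[in 'd (foot d) q _]deriveE // Df foot_front // -deriveE.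
Qed.

End NormalProjection.

(** * Traces on the interface and constancy of the phase *)

Section FirstZero.
Variable R : realType.

(** The smallest zero is the infimum of the set where g <= 0. *)
Lemma first_zero (g : R -> R) :
  (forall r, 0 <= r <= 1 -> {for r, continuous g}) -> 0 < g 0 ->
  (exists2 r, 0 <= r <= 1 & g r <= 0) ->
  exists r, [/\ 0 < r <= 1, g r = 0 & forall r', 0 <= r' < r -> 0 < g r'].
Proof.
move=> cg g0 [r1 r1_in gr1].
pose Z := [set r | 0 <= r <= 1 /\ g r <= 0].
have Z1 : Z r1 by [].
have lbZ : lbound Z 0 by move=> x [/andP[]].
have hZ : has_inf Z by split; [exists r1|exists 0].
pose r := inf Z.
have r0 : 0 <= r by apply: lb_le_inf => //; exists r1.
have rle x : Z x -> r <= x by move=> Zx; apply: ge_inf => //; exists 0.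
have r1' : r <= 1 by apply: (le_trans (rle _ Z1)); case/andP: r1_in.
have before r' : 0 <= r' < r -> 0 < g r'.
  move=> /andP[r'0 r'r]; rewrite ltNge; apply/negP => gr'.
  by have := rle r'; rewrite leNgt r'r => H; apply: (notF (H _)); split=> //;
    rewrite r'0 (le_trans (ltW r'r) r1').
have cr : {for r, continuous g} by apply: cg; rewrite r0.
have gr_le : g r <= 0.
  rewrite leNgt; apply/negP => gr.
  have /nbhs_normP[e e0 H] : \forall x \near r, 0 < g x.
    by move/cvgr_gt : cr => /(_ 0 gr).
  have [z [zin gz] zr] := inf_adherent e0 hZ.
  have : 0 < g z; last by rewrite ltNge gz.
  apply: H => /=; rewrite distrC ger0_norm ?subr_ge0 ?rle // ltrBlDl.
  exact: zr.
have rpos : 0 < r.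
  by rewrite lt_neqAle r0 andbT eq_sym; apply: contraTneq gr_le => ->; rewrite -ltNge.
exists r; split=> //; first by rewrite rpos.
apply/eqP; rewrite eq_le gr_le /= leNgt; apply/negP => gr.
have /nbhs_normP[e e0 H] : \forall x \near r, g x < 0.
  by move/cvgr_lt : cr => /(_ 0 gr).
pose h := Num.min e r / 2.
have m0 : 0 < Num.min e r by rewrite lt_min e0.
have me : Num.min e r <= e by rewrite ge_min lexx.
have mr : Num.min e r <= r by rewrite ge_min lexx orbT.
have : g (r - h) < 0.
  by apply: H => /=; rewrite opprB addrC subrK gtr0_norm /h; lra.
by rewrite ltNge ltW // before // /h; lra.
Qed.

End FirstZero.

Section Traces.
Variables (R : realType) (Omega : set 'rV[R]_3) (T : R) (d : spacetime R -> R^o).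
Hypothesis Hd : evolving_interface Omega T d.
Implicit Types (q : spacetime R) (f g : spacetime R -> R^o) (w : 'rV[R]_3).

Local Notation front := (front Omega T d).
Local Notation bulk := (bulk Omega T d).
Local Notation n_ q := (n_Gamma d q).

(** Since d has slope 1 along the normal, a short normal segment issuing from the
    interface runs into the subdomain, and it stays in any given neighbourhood
    of its origin. *)
Lemma front_ray q s (P : set (spacetime R)) : front q -> (\forall q' \near q, P q') ->
  exists2 del : R, 0 < del & forall r, 0 < r < del ->
    bulk s (q + (sgn R s * r) *: spatial (n_ q)) /\ P (q + (sgn R s * r) *: spatial (n_ q)).
Proof.
move=> Fq Pq; have [qT Oq dq] := iffLR (frontE _ _ _ _) Fq.
pose N := spatial (n_ q); pose C := `|N| + 1.
have C0 : 0 < C by rewrite /C ltr_wpDl.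
(* An error of at most r / 2 at distance r leaves d with the sign of its slope. *)
pose eps := 1 / (2 * C); have eps0 : 0 < eps by rewrite divr_gt0 // mulr_gt0.
have ddq := d_differentiable Hd Fq.
have [rho rho0 H] : exists2 rho : R, 0 < rho & forall v : spacetime R, `|v| < rho ->
    [/\ Omega (q + v).2, P (q + v) &
        `|d (q + v) - d q - 'd d q v| <= eps * `|v|].
  apply: nbhs0_norm; near=> v; split; near: v.
  - exact: (omega_nbhs Hd).
  - exact/(nbhs0P P).
  - exact: (differentiable_small_o ddq eps0).
exists (rho / C); first exact: divr_gt0.
move=> r /andP[r0]; rewrite ltr_pdivlMr // => rrho.
set v := (sgn R s * r) *: N.
have sr : `|sgn R s * r| = r.
  by rewrite normrM (gtr0_norm r0); case: (s) => /=; rewrite ?normrN normr1 mul1r.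
have nv : `|v| <= r * C by rewrite /v normrZ sr ler_pM2l // /C lerDl.
have [] := H v; first exact: le_lt_trans rrho.
move=> Ov Pv; rewrite dq subr0.
have -> : 'd d q v = sgn R s * r.
  rewrite /v linearZ /= -deriveE // (derive_d_spatial Hd) // (normal_unit Hd) //.
  by rewrite [_ *: _]mulr1.
move=> h; split=> //; apply/bulkE; split=> //; first by rewrite /v /= scaler0 addr0.
have {}h : `|d (q + v) - sgn R s * r| <= r / 2.
  apply: (le_trans h); apply: (@le_trans _ _ (eps * (r * C))); first by rewrite ler_pM2l.
  by rewrite /eps le_eqVlt; apply/orP; left; apply/eqP; field; rewrite lt0r_neq0.
move: h; rewrite ler_norml => /andP[h1 h2].
by case: (s) h1 h2 => /=; lra.
Unshelve. all: by end_near. Qed.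

Lemma trace_eq0 q s g : front q -> {for q, continuous g} ->
  (forall q', bulk s q' -> g q' = 0) -> g q = 0.
Proof.
move=> Fq cg g0; apply/eqP/contraT => gq.
have near0 : \forall q' \near q, g q' != 0.
  exact: (cvgr_neq0 (g q) cg gq).
have [del del0 /(_ (del / 2))] := front_ray s Fq near0.
by case; [lra|move=> /g0 -> ; rewrite eqxx].
Qed.

Lemma slice_continuous t (x : 'rV[R]_3) : 0 <= t < T -> Omega x ->
  {for x, continuous (fun y => d (t, y))}.
Proof.
move=> tT Ox.
have /subspace_continuousP/(_ (t, x)) := ei_continuous Hd.
move=> /(_ (conj tT Ox)) dc U HU.
have H : \forall q \near ((t, x) : spacetime R), 0 <= q.1 < T /\ Omega q.2 -> U (d q).
  exact: (dc U HU).
have pc : (fun y : 'rV[R]_3 => ((t, y) : spacetime R)) @ x --> ((t, x) : spacetime R).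
  exact: (@differentiable_continuous _ _ (spacetime R) x (fun y : 'rV[R]_3 => ((t : R^o), y))).
have {}H := pc _ H.
have OO : \forall y \near x, Omega y by exact: open_nbhs_nbhs (conj (ei_open Hd) Ox).
by apply: filterS2 OO H => y Oy; apply.
Qed.

Lemma bulk_nbhs t (x : 'rV[R]_3) s : bulk s (t, x) -> \forall y \near x, bulk s (t, y).
Proof.
move=> /bulkE[/= tT Ox dpos].
have OO : \forall y \near x, Omega y by exact: open_nbhs_nbhs (conj (ei_open Hd) Ox).
have DD : \forall y \near x, 0 < sgn R s * d (t, y).
  have c : (fun y => sgn R s * d (t, y)) @ x --> sgn R s * d (t, x).
    apply: (@cvgM R _ (nbhs x) _ (cst (sgn R s)) (fun y => d (t, y))); first exact: cvg_cst.
    exact: slice_continuous.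
  by move/cvgr_gt : c => /(_ 0 dpos).
by apply: filterS2 OO DD => y Oy dy; apply/bulkE.
Qed.

Lemma bulk_line q s w : bulk s q -> \forall h \near (0 : R), bulk s (q + h *: spatial w).
Proof.
case: q => t x /bulk_nbhs/nbhs0P/(near0Z w).
apply: filterS => h; rewrite /spatial.
suff -> : ((t, x) : spacetime R) + h *: ((0, w) : spacetime R) = (t, x + h *: w) by [].
by congr (_, _); rewrite /= scaler0 addr0.
Qed.

(** Spatial slices of the bulk are open, so identities on it may be
    differentiated in space. *)
Lemma derive_bulk q s w f g : bulk s q -> (forall q', bulk s q' -> f q' = g q') ->
  'D_(spatial w) f q = 'D_(spatial w) g q.
Proof.
move=> Bq fg; apply: near_line_derive.
by have := bulk_line w Bq; apply: filterS => h; exact: fg.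
Qed.

Section PhaseConstant.
Variables (s : side) (phi : spacetime R -> R^o).
Hypothesis phi_smooth : smooth_near (bulk s `|` front) phi.
Hypothesis phi_flat : forall q i, bulk s q -> (phi q ^+ 2 - 1) * 'D_(dir_x i) phi q = 0.
Hypothesis phi_sign : forall q, bulk s q -> 0 < sgn R s * phi q.

(** Four times the double-well energy of phi. *)
Let excess q : R := (phi q ^+ 2 - 1) ^+ 2.

(** (phi^2 - 1) grad phi = 0 makes the excess constant along segments of the
    bulk, and by continuity up to an end point on the interface. *)
Lemma excess_segment q w : (forall r, 0 <= r < 1 -> bulk s (q + r *: spatial w)) ->
  (bulk s `|` front) (q + spatial w) -> excess q = excess (q + spatial w).
Proof.
move=> Hb He.
have Hin r : 0 <= r <= 1 -> (bulk s `|` front) (q + r *: spatial w).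
  move=> /andP[r0]; rewrite le_eqVlt => /predU1P[->|r1]; first by rewrite scale1r.
  by left; apply: Hb; rewrite r0.
have Hphi (r : R) : 0 <= r <= 1 ->
    is_derive r 1 (fun t : R => phi (q + t *: spatial w)) ('D_(spatial w) phi (q + r *: spatial w)).
  by move=> /Hin Hr; apply/is_derive_line/diff_derivable/(smooth_near_differentiable phi_smooth Hr).
pose G (t : R) : R := excess (q + t *: spatial w).
have HG (r : R) : 0 <= r <= 1 -> is_derive r 1 G
    (4 * (phi (q + r *: spatial w)) * ((phi (q + r *: spatial w)) ^+ 2 - 1)
      * 'D_(spatial w) phi (q + r *: spatial w)).
  by move=> /Hphi Hr; rewrite /G /excess; der; ring.
have HG0 (r : R) : r \in `]0, 1[ -> is_derive r 1 G 0.
  rewrite in_itv /= => /andP[r0 r1].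
  have Br : bulk s (q + r *: spatial w) by apply: Hb; rewrite ltW.
  apply: (is_derive_eq (HG r _)); first by rewrite !ltW.
  rewrite derive_spatial; last by apply: smooth_near_differentiable phi_smooth _; left.
  rewrite -mulrA /dot mulr_sumr big1 ?mulr0 // => i _.
  by rewrite mxE mulrA phi_flat // mul0r.
have [|c _] := @MVT R G (fun=> 0) 0 1 ltr01 HG0.
  apply: continuous_in_subspaceT => r; rewrite inE /= in_itv /= => /HG Hr.
  exact: is_derive1_continuous Hr.
by rewrite mul0r /G scale1r scale0r addr0 => /eqP; rewrite subr_eq0 => /eqP.
Qed.

(** The sign survives in the trace: if phi vanished at q, the excess would equal 1
    along the normal ray from q, so phi^2 would be 0 or 2 there, neither of
    which is possible close to q for a phi of constant sign. *)
Lemma phase_front_sign q : front q -> 0 < sgn R s * phi q.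
Proof.
move=> Fq.
have cphi : {for q, continuous phi} by apply: smooth_near_continuous phi_smooth _; right.
have csphi : (fun q => sgn R s * phi q) @ q --> sgn R s * phi q.
  by apply: (@cvgM R _ (nbhs q) _ (cst (sgn R s)) phi) => //; exact: cvg_cst.
have [//|neg|/esym zero] := ltgtP 0 (sgn R s * phi q).
  have H : \forall q' \near q, sgn R s * phi q' < 0 by move/cvgr_lt : csphi => /(_ 0 neg).
  have [del del0 /(_ (del / 2))] := front_ray s Fq H.
  by case; [lra|move=> /phi_sign + ?; lra].
have phi0 : phi q = 0 by case: (s) zero => /=; lra.
have H : \forall q' \near q, phi q' ^+ 2 < 1.
  have c2 : (fun q => phi q * phi q) @ q --> phi q * phi q.
    exact: (@cvgM R _ (nbhs q) _ phi phi).
  by move/cvgr_lt : c2; apply; rewrite phi0 mulr0.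
have [del del0 Hdel] := front_ray s Fq H.
pose r := del / 2.
set N := spatial (n_ q) in Hdel.
pose q' := q + (sgn R s * r) *: N.
have [Bq' small] : bulk s q' /\ phi q' ^+ 2 < 1 by apply: Hdel; rewrite /r; lra.
pose w := - (sgn R s * r) *: n_ q.
have q'E t : q' + t *: spatial w = q + (sgn R s * (r * (1 - t))) *: N.
  have -> : spatial w = - (sgn R s * r) *: N by rewrite /N /w /spatial /=; congr (_, _); rewrite scaler0.
  rewrite /q' -addrA scalerA -scalerDl; congr (_ + _ *: _); ring.
have qE : q' + spatial w = q by rewrite -[spatial w]scale1r q'E subrr !mulr0 scale0r addr0.
have : excess q' = excess (q' + spatial w).
  apply: excess_segment; last by rewrite qE; right.
  move=> t /andP[t0 t1]; rewrite q'E; apply: (proj1 (Hdel _ _)); rewrite /r; nra.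
rewrite qE /excess phi0 => E.
have pos : 0 < phi q' ^+ 2.
  have := phi_sign Bq'; rewrite exprn_even_gt0 //= => h.
  by apply/eqP => h0; move: h; rewrite h0 mulr0 ltxx.
nra.
Qed.

Hypothesis phi_front : forall q, front q -> phi q ^+ 2 = 1.

Let offset t : set 'rV[R]_3 := [set x | bulk s (t, x) /\ excess (t, x) != 0].

(** A segment of Omega starting at a point with phi^2 <> 1 cannot reach the
    interface: at the first crossing the excess would be 0. Hence it stays in
    the subdomain, where the excess is constant. *)
Lemma offset_segment t x w : (forall r, 0 <= r <= 1 -> Omega (x + r *: w)) ->
  offset t x -> offset t (x + w).
Proof.
move=> Ow [Bx ex]; have [/= tT _ dx] := iffLR (bulkE _ _ _ _ _) Bx.
have ptE r : ((t, x) : spacetime R) + r *: spatial w = (t, x + r *: w).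
  by rewrite /spatial; congr (_, _); rewrite /= scaler0 addr0.
have ptE1 : ((t, x) : spacetime R) + spatial w = (t, x + w).
  by rewrite -[spatial w]scale1r ptE scale1r.
pose g r : R := sgn R s * d (t, x + r *: w).
have cg r : 0 <= r <= 1 -> {for r, continuous g}.
  move=> /Ow Or.
  apply: (@cvgM R _ (nbhs r) _ (cst (sgn R s)) (fun r => d (t, x + r *: w))).
    exact: cvg_cst.
  apply: (@continuous_comp _ _ _ (fun r : R => x + r *: w) (fun y => d (t, y))).
    by apply: differentiable_continuous.
  exact: slice_continuous.
have g0 : 0 < g 0 by rewrite /g scale0r addr0.
have bulk_g r : 0 <= r <= 1 -> 0 < g r -> bulk s ((t, x) + r *: spatial w).
  by move=> rin gr; rewrite ptE; apply/bulkE; split=> //=; exact: Ow.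
have [neg|pos] := pselect (exists2 r, 0 <= r <= 1 & g r <= 0).
  have [r [/andP[r0 r1] gr before]] := first_zero cg g0 neg.
  exfalso; move/eqP: ex; apply.
  have Fr : front ((t, x) + spatial (r *: w)).
    have -> : spatial (r *: w) = r *: spatial w by rewrite /spatial; congr (_, _); rewrite scaler0.
    rewrite ptE; apply/frontE; split=> //=; first by apply: Ow; rewrite ltW.
    by move: gr; rewrite /g; case: (s) => /=; lra.
  rewrite (excess_segment (w := r *: w)); [|move=> r' /andP[r'0 r'1]|by right].
    by rewrite /excess (phi_front Fr) subrr expr0n.
  have -> : r' *: spatial (r *: w) = (r' * r) *: spatial w.
    by rewrite -scalerA /spatial; congr (_ *: (_, _)); rewrite scaler0.
  by apply: bulk_g; [nra|apply: before; nra].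
have gpos r : 0 <= r <= 1 -> 0 < g r.
  by move=> rin; rewrite ltNge; apply/negP => gr; apply: pos; exists r.
have Bxw : bulk s ((t, x) + spatial w).
  by rewrite -[spatial w]scale1r; apply: bulk_g; [|apply: gpos]; rewrite ler01 lexx.
split; first by rewrite -ptE1.
rewrite -ptE1 -(excess_segment (w := w)) //; last by left.
by move=> r /andP[r0 /ltW r1]; apply: bulk_g; [|apply: gpos]; rewrite r0.
Qed.

Lemma omega_ball (x : 'rV[R]_3) : Omega x ->
  exists2 rho : R, 0 < rho & forall v, `|v| < rho -> Omega (x + v).
Proof.
move=> Ox; have /nbhs_normP[rho rho0 H] : \forall y \near x, Omega y.
  exact: open_nbhs_nbhs (conj (ei_open Hd) Ox).
by exists rho => // v vr; apply: H; rewrite /= opprD addrA subrr sub0r normrN.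
Qed.

Lemma offset_ball t (x : 'rV[R]_3) rho : (forall v, `|v| < rho -> Omega (x + v)) ->
  forall a b, `|a| < rho -> `|b| < rho -> offset t (x + a) -> offset t (x + b).
Proof.
move=> H a b ar br Bx.
have -> : x + b = x + a + (b - a) by rewrite -addrA (addrC a) subrK.
apply: offset_segment => // r /andP[r0 r1].
have -> : x + a + r *: (b - a) = x + ((1 - r) *: a + r *: b).
  by rewrite -addrA; congr (_ + _); rewrite scalerBr scalerBl scale1r addrAC addrA.
apply: H; apply: (le_lt_trans (ler_normD _ _)); rewrite !normrZ.
rewrite (ger0_norm r0) ger0_norm ?subr_ge0 //.
have [->|r_neq0] := eqVneq r 0; first by rewrite subr0 mul1r mul0r addr0.
have rpos : 0 < r by rewrite lt0r r_neq0.
have : r * `|b| < r * rho by rewrite ltr_pM2l.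
have : (1 - r) * `|a| <= (1 - r) * rho by rewrite ler_wpM2l ?subr_ge0 // ltW.
lra.
Qed.

(** By offset_segment the set of points of Omega with phi^2 <> 1 in the given
    subdomain is open and relatively closed. Omega is connected, so if this set
    were not empty it would be the whole of Omega, which leaves no room for the
    other subdomain. *)
Lemma bulk_phase q : bulk s q -> phi q = sgn R s.
Proof.
move=> Bq; have sphi := phi_sign Bq.
have [|off] := eqVneq (excess q) 0.
  move/eqP; rewrite sqrf_eq0 subr_eq0 => /eqP phi2.
  have : (phi q - sgn R s) * (phi q + sgn R s) = 0 by case: (s) => /=; lra.
  move/eqP; rewrite mulf_eq0 => /orP[|] /eqP h; first by apply/eqP; rewrite -subr_eq0 h.
  by move: sphi h; case: (s) => /=; lra.
exfalso; case: q Bq off sphi => t x Bx off _.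
have Bxo : offset t x by [].
have [/= tT Ox _] := iffLR (bulkE _ _ _ _ _) Bx.
have opn : open (offset t).
  rewrite openE => y By; have [_ Oy _] := iffLR (bulkE _ _ _ _ _) By.1.
  have [rho rho0 H] := omega_ball Oy.
  apply/(nbhs_normP y (offset t)); exists rho => // z /= zr.
  rewrite -[z](subrK y) addrC; apply: (offset_ball H (a := 0)); rewrite ?normr0 // ?addr0 //.
  by rewrite distrC.
have all : offset t = Omega.
  apply: (ei_connected Hd).
  - by exists x.
  - exists (offset t) => //; apply/seteqP; split=> [y By|y [] //].
    by split=> //; have [_ ? _] := iffLR (bulkE _ _ _ _ _) By.1.
  exists (closure (offset t)); first exact: closed_closure.
  apply/seteqP; split=> [y By|y [Oy cy]].
    by split; [have [_ ? _] := iffLR (bulkE _ _ _ _ _) By.1|exact: subset_closure].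
  have [rho rho0 H] := omega_ball Oy.
  have [z [Bz /= zr]] : offset t `&` [set z | `|y - z| < rho] !=set0.
    by apply: cy; apply/(nbhs_normP y [set z | `|y - z| < rho]); exists rho.
  rewrite -[y]addr0; apply: (offset_ball H (a := z - y)); rewrite ?normr0 //.
    by rewrite distrC.
  by rewrite addrC subrK.
have [y [Oy dy]] := ei_two_sides Hd (if s is Plus then Minus else Plus) tT.
have [/bulkE[_ _ /= dy'] _] : offset t y by rewrite all.
by move: dy dy'; case: (s) => /=; lra.
Qed.

End PhaseConstant.

End Traces.

(** * The outer expansion order by order *)

Section Mixtures.
Variables (R : realType).

(** The affine material law on numbers; mix_series below is the same law on
    series. *)
Definition mixture (chi : side -> R) (x : R) : R :=
  (chi Plus - chi Minus) / 2 * x + (chi Plus + chi Minus) / 2.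

Lemma mixture_pure chi s : mixture chi (sgn R s) = chi s.
Proof. by rewrite /mixture; case: s => /=; lra. Qed.

Lemma mixture_pos chi x : (forall s, 0 < chi s) -> x ^+ 2 < 1 -> 0 < mixture chi x.
Proof.
move=> chi0 x1; have := chi0 Plus; have := chi0 Minus; rewrite /mixture => m0 p0.
have xm1 : 0 < x + 1 by nra.
have xp1 : 0 < 1 - x by nra.
by have := mulr_gt0 p0 xm1; have := mulr_gt0 m0 xp1; lra.
Qed.

Variable E : Type.
Implicit Types (a b : series_on R E).

Definition mix_series (chi : side -> R) a : series_on R E :=
  ((chi Plus - chi Minus) / 2) *: a + ((chi Plus + chi Minus) / 2) *: @sone R E.

Lemma starts_at_mix chi a : starts_at 0 a -> starts_at 0 (mix_series chi a).
Proof.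
by move=> Ha; apply: starts_at_add; apply: starts_at_scale => //; exact: starts_at_one.
Qed.

Lemma mix_series0 chi a w : mix_series chi a 0 w = mixture chi (a 0 w).
Proof. by rewrite /mix_series /mixture !fctE /sone eqxx [_ *: 1%:R]mulr1. Qed.

Lemma starts_at_mul0 a b : starts_at 0 a -> starts_at 0 b -> starts_at 0 (smul a b).
Proof. by move=> Ha Hb; have := starts_at_mul Ha Hb. Qed.

Lemma smul0 a b w : starts_at 0 a -> starts_at 0 b -> smul a b 0 w = a 0 w * b 0 w.
Proof. by move=> Ha Hb; have := smul_lead w Ha Hb; rewrite addr0. Qed.

Lemma starts_at_cross (u : 'I_3 -> series_on R E) (B : 'rV[R]_3) p i :
  (forall j, starts_at p (u j)) ->
  starts_at p (B 0 (i + 1 + 1) *: u (i + 1) - B 0 (i + 1) *: u (i + 1 + 1)).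
Proof.
move=> Hu; apply: starts_at_add; first exact: starts_at_scale.
by apply: starts_at_opp; exact: starts_at_scale.
Qed.

End Mixtures.

Section Outer.
Variables (R : realType) (c : parameters R).
Variables (Omega : set 'rV[R]_3) (T : R) (d : spacetime R -> R^o).
Variables (phi_init : nat -> 'rV[R]_3 -> R) (vel_init : 'I_3 -> nat -> 'rV[R]_3 -> R).
Variables (s : side) (F : fields (nat -> spacetime R -> R^o)).
Hypothesis HF : outer_expansion c Omega T d phi_init vel_init s F.

Local Notation bulk := (bulk Omega T d s).
Local Notation st := (spacetime R).
Local Notation Phi := (power_series 0 (phi F) : series_on R st).
Local Notation Mu := (power_series (-1) (mu F) : series_on R st).
Local Notation U i := (power_series 0 (vel F i) : series_on R st).
Local Notation P := (power_series 0 (prs F) : series_on R st).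
Local Notation J i := (power_series 0 (cur F i) : series_on R st).
Local Notation Dx i a := ((fun k => 'D_(dir_x i) ((a : series_on R st) k)) : series_on R st).
Local Notation Dt a := ((fun k => 'D_dir_t ((a : series_on R st) k)) : series_on R st).

Let sP : starts_at 0 P. Proof. exact: starts_at_power_series. Qed.
Let sPhi : starts_at 0 Phi. Proof. exact: starts_at_power_series. Qed.
Let sMu : starts_at (-1) Mu. Proof. exact: starts_at_power_series. Qed.
Let sU i : starts_at 0 (U i). Proof. exact: starts_at_power_series. Qed.
Let sJ i : starts_at 0 (J i). Proof. exact: starts_at_power_series. Qed.

Lemma outer_incompressible q : bulk q -> \sum_i 'D_(dir_x i) (vel F i 0%N) q = 0.
Proof.
move=> Bq; have := dim_incompressible (oe_model HF) 0 q Bq.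
by rewrite /vdiv series_sumE.
Qed.

Lemma outer_charge q : bulk q -> \sum_i 'D_(dir_x i) (cur F i 0%N) q = 0.
Proof.
move=> Bq; have := dim_charge (oe_model HF) 0 q Bq.
by rewrite /vdiv series_sumE.
Qed.

Lemma outer_ohm q i : bulk q ->
  cur F i 0%N q = mixture (sigma_ c) (phi F 0%N q) *
    (- 'D_(dir_x i) (pot F 0%N) q
     + (magB c 0 (i + 1 + 1) * vel F (i + 1) 0%N q
        - magB c 0 (i + 1) * vel F (i + 1 + 1) 0%N q)).
Proof.
move=> Bq; have := dim_ohm (oe_model HF) i 0 q Bq.
rewrite /= -[affine_mix _ _]/(mix_series (sigma_ c) Phi) /cross.
rewrite smul0; first by rewrite mix_series0.
  exact: starts_at_mix.
apply: starts_at_add; last exact: (starts_at_cross _ _ sU).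
apply: starts_at_opp.
exact: (starts_at_derive (dir_x i) (@starts_at_power_series _ _ _ (pot F))).
Qed.

Let Rho := mix_series (rho_ c) Phi.
Let Eta := mix_series (eta_ c) Phi.
Let W j : series_on R st :=
  smul Rho (U j) - rho_d c *: (mob c *: seps 2 (Dx j Mu)).
Let Sym i j : series_on R st := 2^-1 *: (Dx i (U j) + Dx j (U i)).
Let S i j : series_on R st := 2 *: smul Eta (Sym i j) - (i == j)%:R *: P.

Let sRho : starts_at 0 Rho. Proof. exact: starts_at_mix. Qed.
Let sEta : starts_at 0 Eta. Proof. exact: starts_at_mix. Qed.

Let sW j : starts_at 0 (W j).
Proof.
apply: starts_at_add; first exact: starts_at_mul0.
apply: starts_at_opp; do 2!apply: starts_at_scale.
exact: (starts_at_weaken (starts_at_eps (n := 2) (starts_at_derive (dir_x j) sMu))).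

Qed.

Let sSym i j : starts_at 0 (Sym i j).
Proof. by apply: starts_at_scale; apply: starts_at_add; exact: starts_at_derive. Qed.

Let sS i j : starts_at 0 (S i j).
Proof.
apply: starts_at_add; first by apply: starts_at_scale; exact: starts_at_mul0.
by apply: starts_at_opp; exact: starts_at_scale.
Qed.

Let outer_momentum k q i : bulk q ->
  smul Rho (Dt (U i)) k q + \sum_j smul (W j) (Dx j (U i)) k q =
  \sum_j 'D_(dir_x j) (S i j k) q + smul Mu (Dx i Phi) k q
  + (magB c 0 (i + 1 + 1) *: J (i + 1) - magB c 0 (i + 1) *: J (i + 1 + 1)) k q
  + gvec c 0 i * Rho k q.
Proof.
move=> Bq; have := dim_momentum (oe_model HF) i k q Bq.
have <- := series_sumE (index_enum 'I_3) (fun j => smul (W j) (Dx j (U i))) k q.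
have <- := series_sumE (index_enum 'I_3) (fun j => Dx j (S i j)) k q.
rewrite /advect /tdiv /stress /symgrad /cross /affine_mix /=.
rewrite -[RHS]/((_ + _ + _ + _ *: Rho) k q) -[LHS]/((_ + _) k q).
move=> H.
exact: H.
Qed.

(** Order eps^-1 of the momentum balance, where the capillary force mu grad phi
    stands alone. *)
Lemma outer_potential_force q i : bulk q ->
  mu F 0%N q * 'D_(dir_x i) (phi F 0%N) q = 0.
Proof.
move=> Bq; have := outer_momentum (-1) i Bq.
have neg : (-1 : int) < 0 by [].
rewrite starts_at_mul0 //; last exact: starts_at_derive.
rewrite big1; last first.
  by move=> j _; apply: (starts_at_mul0 (sW j)) => //; exact: starts_at_derive.
rewrite [X in _ = X + _ + _ + _]big1; last by move=> j _; apply: derive_eq0 => x; exact: sS.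
rewrite (starts_at_cross _ _ sJ) // sRho // mulr0 !addr0 !add0r.
have := smul_lead q sMu (starts_at_derive (dir_x i) sPhi).
by rewrite addr0 => ->.
Qed.

Hypothesis pure : forall q, bulk q -> phi F 0%N q = sgn R s.
Hypothesis Hd : evolving_interface Omega T d.

(** Once phi_0 = +-1, both mu_0 and grad phi_0 vanish. So the capillary force
    disappears at order 0, and the density and the viscosity are constant; the
    diffusive flux, of order eps^2 eps^-1, does not reach this order. *)
Lemma outer_momentum0 q i : bulk q ->
  rho_ c s * ('D_dir_t (vel F i 0%N) q + \sum_j vel F j 0%N q * 'D_(dir_x j) (vel F i 0%N) q) =
  \sum_j 'D_(dir_x j) (fun q => 2 * (eta_ c s *
      (2^-1 * ('D_(dir_x i) (vel F j 0%N) q + 'D_(dir_x j) (vel F i 0%N) q)))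
      - (i == j)%:R * prs F 0%N q) q
  + (magB c 0 (i + 1 + 1) * cur F (i + 1) 0%N q - magB c 0 (i + 1) * cur F (i + 1 + 1) 0%N q)
  + gvec c 0 i * rho_ c s.
Proof.
move=> Bq; have := outer_momentum 0 i Bq.
have rho0 q' : bulk q' -> Rho 0 q' = rho_ c s.
  by move=> Bq'; rewrite /Rho mix_series0 -[X in mixture _ X]/(phi F 0%N q') pure // mixture_pure.
have eta0 q' : bulk q' -> Eta 0 q' = eta_ c s.
  by move=> Bq'; rewrite /Eta mix_series0 -[X in mixture _ X]/(phi F 0%N q') pure // mixture_pure.
have S0 j : 'D_(dir_x j) (S i j 0) q = 'D_(dir_x j) (fun q => 2 * (eta_ c s *
      (2^-1 * ('D_(dir_x i) (vel F j 0%N) q + 'D_(dir_x j) (vel F i 0%N) q)))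
      - (i == j)%:R * prs F 0%N q) q.
  apply: (derive_bulk Hd (s := s)) => // q' Bq'.
  by rewrite /S !fctE smul0 // eta0.
rewrite (eq_bigr _ (fun j _ => S0 j)).
rewrite smul0 //; last exact: starts_at_derive.
have adv j : smul (W j) (Dx j (U i)) 0 q
    = rho_ c s * (vel F j 0%N q * 'D_(dir_x j) (vel F i 0%N) q).
  rewrite smul0 //; last exact: starts_at_derive.
  rewrite mulrA; congr (_ * _); rewrite /W !fctE smul0 // rho0 //.
  rewrite [X in _ - X](_ : _ = 0) ?subr0 //.
  rewrite [seps _ _ _ _](_ : _ = 0) ?scaler0 //.
  by apply: (starts_at_derive (dir_x j) sMu).
rewrite (eq_bigr _ (fun j _ => adv j)) -mulr_sumr rho0 // -mulrDr => ->.
congr (_ + _ + _).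
rewrite -[RHS]addr0; congr (_ + _).
have := smul_next q sMu (starts_at_derive (dir_x i) sPhi).
rewrite addr0 addNr => ->.
have -> : 'D_(dir_x i) (Phi 0) q = 0.
  transitivity ('D_(dir_x i) (fun=> sgn R s : R^o) q); last exact: derive_cst.
  exact: (@derive_bulk _ _ _ _ Hd q s (delta_mx 0 i) (phi F 0%N) (fun=> sgn R s) Bq pure).
have -> : Mu (-1) q = 0.
  rewrite -[LHS]/(mu F 0%N q) (oe_mu0 HF) // pure //.
  by case: (s); rewrite /= ; ring.
by rewrite mul0r mulr0 addr0.
Qed.

End Outer.

(** * The inner expansion order by order *)

Section Inner.
Variables (R : realType) (c : parameters R).
Variables (Omega : set 'rV[R]_3) (T : R) (d : spacetime R -> R^o).
Variable G : fields (nat -> stretched R -> R^o).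
Hypothesis HG : inner_expansion c Omega T d G.

Local Notation front := (front Omega T d).
Local Notation sd := (stretched R).
Local Notation Phi := (power_series 0 (phi G) : series_on R sd).
Local Notation Mu := (power_series (-1) (mu G) : series_on R sd).
Local Notation U i := (power_series 0 (vel G i) : series_on R sd).
Local Notation P := (power_series 0 (prs G) : series_on R sd).
Local Notation J i := (power_series 0 (cur G i) : series_on R sd).
Local Notation V := (power_series 0 (pot G) : series_on R sd).
Local Notation Dx i a := (inner_deriv d (dir_x i) a).
Local Notation Dt a := (inner_deriv d dir_t a).
Local Notation "'dz' X" := ('D_dir_z X) (at level 10, X at next level).

Let sP : starts_at 0 P. Proof. exact: starts_at_power_series. Qed.
Let sPhi : starts_at 0 Phi. Proof. exact: starts_at_power_series. Qed.
Let sMu : starts_at (-1) Mu. Proof. exact: starts_at_power_series. Qed.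
Let sU i : starts_at 0 (U i). Proof. exact: starts_at_power_series. Qed.
Let sJ i : starts_at 0 (J i). Proof. exact: starts_at_power_series. Qed.
Let sV : starts_at 0 V. Proof. exact: starts_at_power_series. Qed.

Lemma inner_lead0 v (a : series_on R sd) w : starts_at 0 a ->
  inner_deriv d v a (-1) w = 'D_v d w.1 * dz (a 0) w.
Proof. exact: inner_deriv_lead. Qed.

Lemma inner_next0 v (a : series_on R sd) w : starts_at 0 a ->
  inner_deriv d v a 0 w = 'D_v d w.1 * dz (a 1) w + 'D_v (normal_ext d (a 0) w.2) w.1.
Proof. exact: inner_deriv_next. Qed.

Lemma inner_lead1 v (a : series_on R sd) w : starts_at (-1) a ->
  inner_deriv d v a (-2) w = 'D_v d w.1 * dz (a (-1)) w.
Proof. exact: (@inner_deriv_lead _ d v (-1)). Qed.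

Lemma inner_next1 v (a : series_on R sd) w : starts_at (-1) a ->
  inner_deriv d v a (-1) w = 'D_v d w.1 * dz (a 0) w + 'D_v (normal_ext d (a (-1)) w.2) w.1.
Proof. exact: (@inner_deriv_next _ d v (-1)). Qed.

Lemma starts_at_inner0 v (a : series_on R sd) : starts_at 0 a -> starts_at (-1) (inner_deriv d v a).
Proof. exact: starts_at_inner_deriv. Qed.

Lemma starts_at_inner1 v (a : series_on R sd) : starts_at (-1) a -> starts_at (-2) (inner_deriv d v a).
Proof. exact: (@starts_at_inner_deriv _ d v (-1)). Qed.

(** The coefficients are known on the layer only, but z-derivatives at a point of
    the layer stay in it. *)
Lemma dz_line (X Y : sd -> R^o) (q : spacetime R) (z : R) : (forall z', X (q, z') = Y (q, z')) -> dz X (q, z) = dz Y (q, z).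
Proof.
move=> XY; apply: near_line_derive; exists 1 => [|h _] //=.
have -> : ((q, z) : sd) + h *: dir_z = (q, z + h) by congr (_, _); rewrite /= ?scaler0 ?addr0 // [h *: 1]mulr1.
exact: XY.
Qed.

Lemma inner_incompressible q z : front q ->
  \sum_i 'D_(dir_x i) d q * dz (vel G i 0%N) (q, z) = 0.
Proof.
move=> Fq; have := dim_incompressible (ie_model HG) (-1) (q, z) Fq.
rewrite /vdiv series_sumE /= => E; rewrite -[RHS]E; apply: eq_bigr => i _.
by rewrite inner_lead0.
Qed.

Lemma inner_charge q z : front q ->
  \sum_i 'D_(dir_x i) d q * dz (cur G i 0%N) (q, z) = 0.
Proof.
move=> Fq; have := dim_charge (ie_model HG) (-1) (q, z) Fq.
rewrite /vdiv series_sumE /= => E; rewrite -[RHS]E; apply: eq_bigr => i _.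
by rewrite inner_lead0.
Qed.

Lemma inner_ohm q z i : front q ->
  0 = mixture (sigma_ c) (phi G 0%N (q, z)) * ('D_(dir_x i) d q * dz (pot G 0%N) (q, z)).
Proof.
move=> Fq; have := dim_ohm (ie_model HG) i (-1) (q, z) Fq.
rewrite /= -[affine_mix _ _]/(mix_series (sigma_ c) Phi) /cross.
have sE : starts_at (-1) (- Dx i V + (magB c 0 (i + 1 + 1) *: U (i + 1) - magB c 0 (i + 1) *: U (i + 1 + 1))).
  apply: starts_at_add; first by apply: starts_at_opp; exact: starts_at_inner0.
  by apply: (@starts_at_weaken _ _ 0) => //; exact: (starts_at_cross _ _ sU).
have := smul_lead (q, z) (starts_at_mix (sigma_ c) sPhi) sE.
rewrite add0r => ->; rewrite mix_series0 sJ //.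
rewrite -[(_ + _ : series_on R sd) _ _]/((- Dx i V) (-1) (q, z) + (magB c 0 (i + 1 + 1) *: U (i + 1) - magB c 0 (i + 1) *: U (i + 1 + 1)) (-1) (q, z)).
rewrite (starts_at_cross _ _ sU) // addr0 -[(- Dx i V) _ _]/(- (Dx i V (-1) (q, z))).
by rewrite inner_lead0 // mulrN => /esym/eqP; rewrite oppr_eq0 => /eqP ->.
Qed.

Lemma inner_phase q z : front q ->
  'D_dir_t d q * dz (phi G 0%N) (q, z)
  + \sum_i 'D_(dir_x i) d q * dz (fun w => phi G 0%N w * vel G i 0%N w) (q, z)
  = \sum_i 'D_(dir_x i) d q *
      dz (fun w => mob c * ('D_(dir_x i) d w.1 * dz (mu G 0%N) w)) (q, z).
Proof.
move=> Fq; have := dim_phase (ie_model HG) (-1) (q, z) Fq.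
rewrite /vdiv /=.
rewrite -[LHS]/(Dt Phi (-1) (q, z) + (\sum_i Dx i (smul Phi (U i))) (-1) (q, z)).
rewrite !series_sumE inner_lead0 // => E.
transitivity ('D_dir_t d (q, z).1 * dz (Phi 0) (q, z)
  + \sum_(i < 3) Dx i (smul Phi (U i)) (-1) (q, z)).
  congr (_ + _); apply: eq_bigr => i _.
  rewrite inner_lead0; last exact: starts_at_mul0.
  by congr (_ * _); apply: dz_line => z'; rewrite smul0.
rewrite E; apply: eq_bigr => i _.
have sM : starts_at 0 (mob c *: seps 2 (Dx i Mu)).
  apply: starts_at_scale.
  exact: (starts_at_weaken (starts_at_eps (n := 2) (starts_at_inner1 (dir_x i) sMu))).
rewrite inner_lead0 //; congr (_ * _); apply: dz_line => z'.
rewrite -[LHS]/(mob c * Dx i Mu (-2) (q, z')).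
by rewrite inner_lead1.
Qed.

Let Rho := mix_series (rho_ c) Phi.
Let Eta := mix_series (eta_ c) Phi.
Let W j : series_on R sd :=
  smul Rho (U j) - rho_d c *: (mob c *: seps 2 (Dx j Mu)).
Let Sym i j : series_on R sd := 2^-1 *: (Dx i (U j) + Dx j (U i)).
Let S i j : series_on R sd := 2 *: smul Eta (Sym i j) - (i == j)%:R *: P.

Let sRho : starts_at 0 Rho. Proof. exact: starts_at_mix. Qed.
Let sEta : starts_at 0 Eta. Proof. exact: starts_at_mix. Qed.

Let sW j : starts_at 0 (W j).
Proof.
apply: starts_at_add; first exact: starts_at_mul0.
apply: starts_at_opp; do 2!apply: starts_at_scale.
exact: (starts_at_weaken (starts_at_eps (n := 2) (starts_at_inner1 (dir_x j) sMu))).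
Qed.

Let sSym i j : starts_at (-1) (Sym i j).
Proof. by apply: starts_at_scale; apply: starts_at_add; exact: starts_at_inner0. Qed.

Let sES i j : starts_at (-1) (smul Eta (Sym i j)).
Proof. by have := starts_at_mul sEta (sSym i j); rewrite add0r. Qed.

Let sS i j : starts_at (-1) (S i j).
Proof.
apply: starts_at_add; first by apply: starts_at_scale; exact: sES.
by apply: starts_at_opp; apply: starts_at_scale; apply: (starts_at_weaken sP).
Qed.

Let inner_momentum k w i : front w.1 ->
  smul Rho (Dt (U i)) k w + \sum_j smul (W j) (Dx j (U i)) k w =
  \sum_j Dx j (S i j) k w + smul Mu (Dx i Phi) k w
  + (magB c 0 (i + 1 + 1) *: J (i + 1) - magB c 0 (i + 1) *: J (i + 1 + 1)) k w
  + gvec c 0 i * Rho k w.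
Proof.
move=> Fw; have := dim_momentum (ie_model HG) i k w Fw.
have <- := series_sumE (index_enum 'I_3) (fun j => smul (W j) (Dx j (U i))) k w.
have <- := series_sumE (index_enum 'I_3) (fun j => Dx j (S i j)) k w.
rewrite /advect /tdiv /stress /symgrad /cross /affine_mix /=.
rewrite -[RHS]/((_ + _ + _ + _ *: Rho) k w) -[LHS]/((_ + _) k w).
move=> H.
exact: H.
Qed.

(** Coefficient of eps^-1 in the stress of the layer. *)
Definition viscous_lead i j (w : sd) : R := 2 * (mixture (eta_ c) (phi G 0%N w) *
  (2^-1 * ('D_(dir_x i) d w.1 * dz (vel G j 0%N) w + 'D_(dir_x j) d w.1 * dz (vel G i 0%N) w))).

Let S_lead i j w : S i j (-1) w = viscous_lead i j w.
Proof.
have H := smul_lead w sEta (sSym i j); rewrite add0r in H.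
rewrite -[LHS]/(2 * smul Eta (Sym i j) (-1) w - (i == j)%:R * P (-1) w).
rewrite H [Eta 0 w]mix_series0 (sP w (k := -1)) // mulr0 subr0.
rewrite -[Sym i j (-1) w]/(2^-1 * (Dx i (U j) (-1) w + Dx j (U i) (-1) w)).
by rewrite !inner_lead0.
Qed.

(** Coefficient of order 0 in the strain rate; layer_stress below is the
    coefficient of order 0 in the stress, provided that the leading velocity
    does not depend on z. *)
Definition layer_strain i j (w : sd) : R :=
  2^-1 * (('D_(dir_x i) d w.1 * dz (vel G j 1%N) w + 'D_(dir_x i) (normal_ext d (vel G j 0%N) w.2) w.1)
        + ('D_(dir_x j) d w.1 * dz (vel G i 1%N) w + 'D_(dir_x j) (normal_ext d (vel G i 0%N) w.2) w.1)).

Definition layer_stress i j (w : sd) : R :=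
  2 * (mixture (eta_ c) (phi G 0%N w) * layer_strain i j w) - (i == j)%:R * prs G 0%N w.

Let S_next i j w : (forall k, dz (vel G k 0%N) w = 0) -> S i j 0 w = layer_stress i j w.
Proof.
move=> u0; have H := smul_next w sEta (sSym i j); rewrite add0r addNr in H.
rewrite -[LHS]/(2 * smul Eta (Sym i j) 0 w - (i == j)%:R * P 0 w).
rewrite H [Eta 0 w]mix_series0 /layer_stress; congr (2 * _ - _).
rewrite -[Sym i j (-1) w]/(2^-1 * (Dx i (U j) (-1) w + Dx j (U i) (-1) w)).
rewrite !inner_lead0 // -[Sym i j 0 w]/(2^-1 * (Dx i (U j) 0 w + Dx j (U i) 0 w)).
rewrite !inner_next0 //.
have u0' k : dz (U k 0) w = 0 by exact: u0.
by rewrite !u0' !(mulr0, addr0).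
Qed.

(** Order eps^-2: inertia starts one order later. *)
Lemma inner_momentum_lead q z i : front q ->
  0 = \sum_j 'D_(dir_x j) d q * dz (viscous_lead i j) (q, z)
    + mu G 0%N (q, z) * ('D_(dir_x i) d q * dz (phi G 0%N) (q, z)).
Proof.
move=> Fq; have := inner_momentum (-2) (w := (q, z)) i Fq.
have Hd j a : starts_at 0 a -> starts_at (-1) (smul a (Dx j (U i))).
  by move=> sa; have := starts_at_mul sa (starts_at_inner0 (dir_x j) (sU i)); rewrite add0r.
have Ht := starts_at_mul sRho (starts_at_inner0 dir_t (sU i)).
rewrite (Ht _ _ _) // add0r big1; last by move=> j _; apply: (Hd j _ (sW j)).
rewrite (starts_at_cross _ _ sJ) // (sRho (k := -2)) // mulr0 !addr0 => E.
rewrite [LHS]E {E}; congr (_ + _).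
  by apply: eq_bigr => j _; rewrite inner_lead1 //; congr (_ * _); apply: dz_line => z'.
have := smul_lead (q, z) sMu (starts_at_inner0 (dir_x i) sPhi).
by rewrite inner_lead0.
Qed.

(** Order eps^-1. Inertia starts with d_z of the leading velocity and drops out
    with it. *)
Lemma inner_momentum_next q z i : front q ->
  (forall z' k, dz (vel G k 0%N) (q, z') = 0) ->
  mu G 0%N (q, z) = 0 ->
  (forall j, 'D_(dir_x j) (normal_ext d (viscous_lead i j) z) q = 0) ->
  0 = \sum_j 'D_(dir_x j) d q * dz (layer_stress i j) (q, z)
    + mu G 1%N (q, z) * ('D_(dir_x i) d q * dz (phi G 0%N) (q, z)).
Proof.
move=> Fq u0 mu0 vis; have := inner_momentum (-1) (w := (q, z)) i Fq.
have lead j a : starts_at 0 a -> smul a (inner_deriv d j (U i)) (-1) (q, z) = 0.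
  move=> sa; have := smul_lead (q, z) sa (starts_at_inner0 j (sU i)).
  by rewrite add0r => ->; rewrite inner_lead0 // u0 !mulr0.
rewrite lead // big1; last by move=> j _; rewrite lead.
rewrite (starts_at_cross _ _ sJ) // (sRho (k := -1)) // mulr0 !addr0 => E.
rewrite [LHS]E {E}; congr (_ + _).
  apply: eq_bigr => j _; rewrite inner_next1 // [X in _ + X](_ : _ = 0) ?addr0.
    by congr (_ * _); apply: dz_line => z'; rewrite S_next.
  rewrite -[RHS](vis j); congr ('D_(dir_x j) (normal_ext d _ z) q).
  by apply/funext => w; rewrite S_lead.
have := smul_next (q, z) sMu (starts_at_inner0 (dir_x i) sPhi).
rewrite addNr -[-1 + -1 + 1 : int]/(-1 : int) => ->.
by rewrite -[Mu (-1) (q, z)]/(mu G 0%N (q, z)) mu0 mul0r add0r inner_lead0.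
Qed.

End Inner.

(** * Matching across the layer *)

Section NormalLine.
Variable R : realType.
Implicit Types (X : stretched R -> R^o) (q : spacetime R) (z : R).

Lemma dir_z_line q z : ((q, 0) : stretched R) + z *: dir_z = (q, z).
Proof. by congr (_, _); rewrite /= ?scaler0 ?addr0 // add0r [_ *: _]mulr1. Qed.

Lemma derive_z X q z : 'D_dir_z X (q, z) = 'D_1 (fun t : R => X (q, t)) z.
Proof.
rewrite -[in LHS]dir_z_line derive_line; congr ('D_1 _ z).
by apply/funext => t; rewrite dir_z_line.
Qed.

Lemma is_derive_z X q z (l : R) : is_derive z 1 (fun t : R => X (q, t)) l ->
  is_derive z 1 (fun t : R => X (q, t)) ('D_dir_z X (q, z)).
Proof. by move=> H; rewrite derive_z; apply: derivableP; case: H. Qed.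

Lemma smooth_derive_z (A : set (stretched R)) X q z : smooth_near A X -> A (q, z) ->
  is_derive z 1 (fun t : R => X (q, t)) ('D_dir_z X (q, z)).
Proof.
move=> sX Aq; rewrite -[in 'D_dir_z X _]dir_z_line.
rewrite (_ : (fun t => _) = (fun t : R => X ((q, 0) + t *: dir_z))); last first.
  by apply/funext => t; rewrite dir_z_line.
apply: is_derive_line; rewrite dir_z_line; apply: diff_derivable.
exact: smooth_near_differentiable sX Aq.
Qed.

Lemma der_sum n (f : 'I_n -> R -> R) (df : 'I_n -> R) z :
  (forall i, is_derive z 1 (f i) (df i)) ->
  is_derive z 1 (fun t : R => \sum_i f i t) (\sum_i df i).
Proof. by move=> H; rewrite -[X in is_derive _ _ X _]fct_sumE; exact: is_derive_sum. Qed.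

Lemma cvg_sum_infty (s : side) n (f : 'I_n -> R -> R) (l : 'I_n -> R) :
  (forall i, f i @ @infty R s --> l i) ->
  (fun t : R => \sum_i f i t) @ @infty R s --> \sum_i l i.
Proof.
move=> H; rewrite -fct_sumE.
elim/big_ind2: _ => [|a b a' b' ? ?|i _]; [exact: cvg_cst|exact: cvgD|exact: H].
Qed.

Lemma der_mixture (chi : side -> R) (f : R -> R) (z l : R) : is_derive z 1 f l ->
  is_derive z 1 (fun t : R => mixture chi (f t)) ((chi Plus - chi Minus) / 2 * l).
Proof. by move=> Hf; rewrite /mixture; der; ring. Qed.

Lemma cvg_mixture (s : side) (chi : side -> R) (f : R -> R) (l : R) :
  f @ @infty R s --> l -> (fun t => mixture chi (f t)) @ @infty R s --> mixture chi l.
Proof.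
move=> fl; apply: cvgD; last exact: cvg_cst.
by apply: cvgM => //; exact: cvg_cst.
Qed.

End NormalLine.

Section Limit.
Variables (R : realType) (c : parameters R) (Omega : set 'rV[R]_3) (T : R).
Variable (d : spacetime R -> R^o).
Variables (phi_init : nat -> 'rV[R]_3 -> R) (vel_init : 'I_3 -> nat -> 'rV[R]_3 -> R).
Variable F : side -> fields (nat -> spacetime R -> R^o).
Variable G : fields (nat -> stretched R -> R^o).
Hypothesis Hc : parameters_pos c.
Hypothesis Hd : evolving_interface Omega T d.
Hypothesis HF : forall s, outer_expansion c Omega T d phi_init vel_init s (F s).
Hypothesis HG : inner_expansion c Omega T d G.
Hypothesis HM : forall s, all_fields2 (matched Omega T d s) G (F s).

Local Notation front := (front Omega T d).
Local Notation bulk := (bulk Omega T d).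
Local Notation n_ q := (n_Gamma d q).
Local Notation dz X := ('D_dir_z X).
Local Notation lay := (layer Omega T d).

Let lh := lambda_hat c.

Lemma lambda_hat_gt0 : 0 < lh.
Proof.
have [_ _ _ [lam0 _ _]] := Hc.
by rewrite /lh /lambda_hat divr_gt0 ?mulr_gt0 // sqrtr_gt0.
Qed.

Lemma outer_smooth_phi s k : smooth_near (bulk s `|` front) (phi (F s) k).
Proof. by have [+ _ _ _ _] := oe_smooth (HF s). Qed.

Lemma outer_smooth_mu s k : smooth_near (bulk s `|` front) (mu (F s) k).
Proof. by have [_ + _ _ _] := oe_smooth (HF s). Qed.

Lemma outer_smooth_vel s i k : smooth_near (bulk s `|` front) (vel (F s) i k).
Proof. by have [_ _ + _ _] := oe_smooth (HF s). Qed.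

(** mu_0 grad phi_0 = 0 with mu_0 = lambda_hat phi_0 (phi_0^2 - 1) and
    phi_0 <> 0. *)
Lemma outer_flat s q i : bulk s q ->
  (phi (F s) 0%N q ^+ 2 - 1) * 'D_(dir_x i) (phi (F s) 0%N) q = 0.
Proof.
move=> Bq; have := outer_potential_force (HF s) i Bq.
rewrite (oe_mu0 (HF s) Bq); set D := 'D__ _ _.
have ph := oe_sign (HF s) Bq; move: ph; set p := phi _ _ _ => ph.
rewrite (_ : _ * D = (lh * p) * ((p ^+ 2 - 1) * D)); last by rewrite /lh; ring.
move/eqP; rewrite mulf_eq0 => /orP[|/eqP //].
rewrite mulf_eq0 (gt_eqF lambda_hat_gt0) /= => /eqP p0.
by move: ph; rewrite p0 mulr0 ltxx.
Qed.

Lemma front_sign s q : front q -> 0 < sgn R s * phi (F s) 0%N q.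
Proof.
exact: (phase_front_sign Hd (outer_smooth_phi s 0%N) (@outer_flat s) (oe_sign (HF s))).
Qed.

(** The bulk relation passes to the trace by continuity. *)
Lemma front_mu0 s q : front q ->
  mu (F s) 0%N q = lh * (phi (F s) 0%N q ^+ 3 - phi (F s) 0%N q).
Proof.
move=> Fq; apply/eqP; rewrite -subr_eq0; apply/eqP.
(* The cube is written as a product for the differentiation rules. *)
pose g (q : spacetime R) : R^o := mu (F s) 0%N q -
  lh * (phi (F s) 0%N q * phi (F s) 0%N q * phi (F s) 0%N q - phi (F s) 0%N q).
have -> : mu (F s) 0%N q - lh * (phi (F s) 0%N q ^+ 3 - phi (F s) 0%N q) = g q.
  by rewrite /g; ring.
have inA : (bulk s `|` front) q by right.
have cp := smooth_near_differentiable (outer_smooth_phi s 0%N) inA.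
have cm := smooth_near_differentiable (outer_smooth_mu s 0%N) inA.
apply: (trace_eq0 Hd (s := s) Fq).
  apply: differentiable_continuous; apply: differentiableB => //.
  apply: differentiableM; first exact: differentiable_cst.
  by apply: differentiableB => //; apply: differentiableM => //; exact: differentiableM.
by move=> q' Bq'; rewrite /g (oe_mu0 (HF s) Bq') /lh; ring.
Qed.

Section AtFrontPoint.
Variable q : spacetime R.
Hypothesis Fq : front q.

Let n i : R := 'D_(dir_x i) d q.

Let nE i : n_ q 0 i = n i. Proof. by rewrite mxE. Qed.

Let nn : \sum_i n i * n i = 1.
Proof. by rewrite -[RHS](normal_unit Hd Fq); apply: eq_bigr => i _; rewrite nE. Qed.

Let line X z : smooth_near lay X -> is_derive (z : R) 1 (fun t : R => X (q, t)) (dz X (q, z)).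
Proof. by move=> sX; exact: smooth_derive_z sX _. Qed.

Lemma smooth_phi k : smooth_near lay (phi G k).
Proof. by have [+ _ _ _ _] := ie_smooth HG. Qed.
Lemma smooth_mu k : smooth_near lay (mu G k).
Proof. by have [_ + _ _ _] := ie_smooth HG. Qed.
Lemma smooth_vel i k : smooth_near lay (vel G i k).
Proof. by have [_ _ + _ _] := ie_smooth HG. Qed.
Lemma smooth_prs k : smooth_near lay (prs G k).
Proof. by have [_ _ _ + _] := ie_smooth HG. Qed.
Lemma smooth_cur i k : smooth_near lay (cur G i k).
Proof. by have [_ _ _ _ [+ _]] := ie_smooth HG. Qed.
Lemma smooth_pot k : smooth_near lay (pot G k).
Proof. by have [_ _ _ _ [_ +]] := ie_smooth HG. Qed.

Let ph z : R := phi G 0%N (q, z).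
Let dph z : R := dz (phi G 0%N) (q, z).
Let ddph z : R := dz (dz (phi G 0%N)) (q, z).
Let un z : R := \sum_i n i * vel G i 0%N (q, z).

Let Hph (z : R) : is_derive z 1 ph (dph z).
Proof. exact: line (smooth_phi 0%N). Qed.

Let Hdph (z : R) : is_derive z 1 dph (ddph z).
Proof. exact: line (smooth_near_derive _ (smooth_phi 0%N)). Qed.

Let Hun (z : R) : is_derive z 1 un 0.
Proof.
have <- := inner_incompressible HG z Fq; apply: der_sum => i.
apply: (is_derive_eq (der_M (der_cst _ _ (n i)) (line z (smooth_vel i 0%N)))).
by rewrite mulr0 addr0.
Qed.

Let lph s : ph @ @infty R s --> phi (F s) 0%N q.
Proof. by have [/(_ q Fq)[+ _ _] _ _ _ _] := HM s. Qed.

Let ldph s : dph @ @infty R s --> (0 : R).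
Proof. by have [/(_ q Fq)[_ + _] _ _ _ _] := HM s. Qed.

Let unc z : un z = un 0. Proof. exact: is_derive0_cst. Qed.

Let front_distinct : phi (F Plus) 0%N q != phi (F Minus) 0%N q.
Proof.
apply/eqP => E; have := front_sign Plus Fq; have := front_sign Minus Fq.
by rewrite /= E; lra.
Qed.

(** Order eps^-1 of the phase equation: incompressibility makes the normal
    velocity un independent of z, so only un - V_Gamma multiplies d_z phi_0. *)
Let mass_balance z : (un 0 - V_Gamma d q) * dph z = mob c * dz (dz (mu G 0%N)) (q, z).
Proof.
have Hmu : is_derive z 1 (fun t : R => dz (mu G 0%N) (q, t)) (dz (dz (mu G 0%N)) (q, z)).
  exact: line (smooth_near_derive _ (smooth_mu 0%N)).
have E := inner_phase HG z Fq.
have lhs i : dz (fun w => phi G 0%N w * vel G i 0%N w) (q, z)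
    = ph z * dz (vel G i 0%N) (q, z) + vel G i 0%N (q, z) * dph z.
  rewrite derive_z; apply: derive_val.
  exact: der_M (Hph z) (line z (smooth_vel i 0%N)).
have rhs i : dz (fun w => mob c * ('D_(dir_x i) d w.1 * dz (mu G 0%N) w)) (q, z)
    = mob c * (n i * dz (dz (mu G 0%N)) (q, z)).
  rewrite derive_z; apply: derive_val.
  by apply: (is_derive_eq (der_M (der_cst _ _ _) (der_M (der_cst _ _ (n i)) Hmu))); ring.
rewrite (eq_bigr _ (fun i _ => congr1 _ (lhs i))) in E.
rewrite (eq_bigr _ (fun i _ => congr1 _ (rhs i))) in E.
have L : \sum_(i < 3) 'D_(dir_x i) d q * (ph z * dz (vel G i 0%N) (q, z) + vel G i 0%N (q, z) * dph z)
     = un z * dph z.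
  transitivity (ph z * \sum_(i < 3) 'D_(dir_x i) d q * dz (vel G i 0%N) (q, z) + un z * dph z).
    rewrite /un mulr_sumr mulr_suml -big_split /=; apply: eq_bigr => i _.
    by rewrite /n; ring.
  by rewrite (inner_incompressible HG z Fq) mulr0 add0r.
have Rr : \sum_(i < 3) 'D_(dir_x i) d q * (mob c * (n i * dz (dz (mu G 0%N)) (q, z)))
     = mob c * dz (dz (mu G 0%N)) (q, z).
  rewrite -[RHS]mul1r -nn mulr_suml; apply: eq_bigr => i _; rewrite /n; ring.
rewrite L Rr in E.
by rewrite -E unc /V_Gamma -/(dph z); ring.
Qed.

Let kinematic : un 0 = V_Gamma d q /\ forall z z', mu G 0%N (q, z) = mu G 0%N (q, z').
Proof.
have Hmu (z : R) := line z (smooth_mu 0%N).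
have Hdmu (z : R) := line z (smooth_near_derive dir_z (smooth_mu 0%N)).
have ldmu s : (fun z => dz (mu G 0%N) (q, z)) @ @infty R s --> (0 : R).
  by have [_ /(_ q Fq)[_ + _] _ _ _] := HM s.
have [_ _ _ [_ m0 _]] := Hc.
exact: (inner_phase_balance Hph Hmu Hdmu mass_balance lph ldmu (lt0r_neq0 m0) front_distinct).
Qed.

Let potential_and_phase : (forall z, mu G 0%N (q, z) = 0) /\ forall s, phi (F s) 0%N q = sgn R s.
Proof.
have lh0 := lambda_hat_gt0; have [_ muc] := kinematic.
have muE z : mu G 0%N (q, z) = lh * (- ddph z + ph z ^+ 3 - ph z) by exact: (ie_mu0 HG).
have mulim s : mu G 0%N (q, 0) = lh * (phi (F s) 0%N q ^+ 3 - phi (F s) 0%N q).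
  rewrite -front_mu0 //; apply/esym; apply: (@cvg_const_infty _ s (fun z => mu G 0%N (q, z))) => //.
  by have [_ /(_ q Fq)[+ _ _] _ _ _] := HM s.
pose K := mu G 0%N (q, 0) / lh.
have [] := @equal_area _ ph dph K (fun s => phi (F s) 0%N q) Hph _ lph ldph.
- move=> z; apply: (is_derive_eq (Hdph z)).
  by rewrite /K (muc 0 z) muE; field; rewrite lt0r_neq0.
- by move=> s; rewrite /K (mulim s); field; rewrite lt0r_neq0.
- by move=> s; exact: front_sign.
move=> K0 pure; split=> // z; rewrite (muc z 0).
by move/eqP: K0; rewrite /K mulf_eq0 invr_eq0 (gt_eqF lh0) orbF => /eqP.
Qed.

Lemma front_phase s : phi (F s) 0%N q = sgn R s.
Proof. by have [_ ->] := potential_and_phase. Qed.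

Let lph1 s : ph @ @infty R s --> sgn R s.
Proof. by have := @lph s; rewrite front_phase. Qed.

Lemma potential_zero z : mu G 0%N (q, z) = 0.
Proof. by have [->] := potential_and_phase. Qed.

Let Hdph3 (z : R) : is_derive z 1 dph (ph z ^+ 3 - ph z).
Proof.
apply: (is_derive_eq (Hdph z)); have [/(_ z) + _] := potential_and_phase.
rewrite (ie_mu0 HG (w := (q, z)) Fq) -/lh -[dz (dz _) _]/(ddph z) -[phi _ _ _]/(ph z).
by move/eqP; rewrite mulf_eq0 (gt_eqF lambda_hat_gt0) /= => /eqP; lra.
Qed.

Let profile z : dph z = (1 - ph z ^+ 2) / Num.sqrt 2 /\ ph z ^+ 2 < 1.
Proof.
apply: (transition_profile Hph Hdph3 lph1 ldph).
exact: (ie_center HG).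
Qed.

Lemma profile_derive2 (z : R) : is_derive z 1 (fun t : R => dz (phi G 0%N) (q, t))
  (phi G 0%N (q, z) ^+ 3 - phi G 0%N (q, z)).
Proof. exact: Hdph3. Qed.

Lemma profile_eq z : dz (phi G 0%N) (q, z) = (1 - phi G 0%N (q, z) ^+ 2) / Num.sqrt 2
  /\ phi G 0%N (q, z) ^+ 2 < 1.
Proof. exact: profile. Qed.

Let mixture_gt0 (chi : side -> R) z : (forall s, 0 < chi s) -> 0 < mixture chi (ph z).
Proof. by move=> chi0; apply: mixture_pos => //; case: (profile z). Qed.

Let visc_line i j (z : R) : is_derive z 1 (fun t : R => viscous_lead c d G i j (q, t))
  (dz (viscous_lead c d G i j) (q, z)).
Proof.
have Hu k := line z (smooth_near_derive dir_z (smooth_vel k 0%N)).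
have H1 := der_D (der_M (der_cst z 1 (n i)) (Hu j)) (der_M (der_cst z 1 (n j)) (Hu i)).
have H2 := der_M (der_mixture (eta_ c) (Hph z)) (der_M (der_cst z 1 (2^-1 : R)) H1).
exact: (is_derive_z (X := viscous_lead c d G i j) (der_M (der_cst z 1 (2 : R)) H2)).
Qed.

(** At order eps^-2 the capillary force is 0, so the normal component of the
    viscous stress, which incompressibility reduces to eta d_z u, is constant in
    z; it vanishes at infinity, and eta > 0 because the profile stays between -1
    and 1. *)
Lemma inner_velocity_constant i z : dz (vel G i 0%N) (q, z) = 0.
Proof.
have [_ eta0 _ _] := Hc; have [mu0 _] := potential_and_phase.
pose A t : R := \sum_j n j * viscous_lead c d G i j (q, t).
have AE t : A t = mixture (eta_ c) (ph t) * dz (vel G i 0%N) (q, t).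
  pose e : R := mixture (eta_ c) (ph t); pose du j : R := dz (vel G j 0%N) (q, t).
  have term j : n j * viscous_lead c d G i j (q, t)
      = e * n i * (n j * du j) + e * du i * (n j * n j).
    rewrite -[viscous_lead _ _ _ _ _ _]/(2 * (e * (2^-1 * (n i * du j + n j * du i)))).
    by move: e du (n i) (n j) => e du a b; field.
  rewrite /A (eq_bigr _ (fun j _ => term j)) big_split /= -!mulr_sumr nn mulr1.
  by rewrite [X in _ * X + _](inner_incompressible HG t Fq) mulr0 add0r.
have HA (t : R) : is_derive t 1 A 0.
  have := inner_momentum_lead HG t i Fq; rewrite mu0 mul0r addr0 => ->.
  apply: der_sum => j; apply: (is_derive_eq (der_M (der_cst _ _ (n j)) (visc_line i j t))).
  by rewrite mulr0 addr0.
have lA : A @ @infty R Plus --> mixture (eta_ c) (sgn R Plus) * 0.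
  rewrite (_ : A = fun t => mixture (eta_ c) (ph t) * dz (vel G i 0%N) (q, t)); last exact/funext.
  apply: cvgM; first exact: cvg_mixture.
  by have [_ _ /(_ i q Fq)[_ + _] _ _] := HM Plus.
have := first_integral_limit z HA lA; rewrite AE mulr0 => /eqP.
by rewrite mulf_eq0 (gt_eqF (mixture_gt0 z eta0)) /= => /eqP.
Qed.

Lemma inner_velocity s i z : vel G i 0%N (q, z) = vel (F s) i 0%N q.
Proof.
apply: (@first_integral_limit _ s (fun z => vel G i 0%N (q, z))).
  by move=> x; rewrite -(inner_velocity_constant i x); exact: line (smooth_vel i 0%N).
by have [_ _ /(_ i q Fq)[+ _ _] _ _] := HM s.
Qed.

Lemma front_kinematic s : V_Gamma d q = \sum_i vel (F s) i 0%N q * n_ q 0 i.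
Proof.
have [<- _] := kinematic; apply: eq_bigr => i _.
by rewrite (inner_velocity s) nE mulrC.
Qed.

(** Ohm's law at order eps^-1: sigma d_z V = 0 with sigma > 0. *)
Lemma front_potential_jump : pot (F Plus) 0%N q = pot (F Minus) 0%N q.
Proof.
have [_ _ sig0 _] := Hc.
have V0 (z : R) : is_derive z 1 (fun t : R => pot G 0%N (q, t)) 0.
  suff <- : dz (pot G 0%N) (q, z) = 0 by exact: line (smooth_pot 0%N).
  rewrite -[LHS]mul1r -nn mulr_suml big1 // => i _.
  have := inner_ohm HG z i Fq => /esym/eqP.
  rewrite mulf_eq0 (gt_eqF (mixture_gt0 z sig0)) /= => /eqP h.
  by rewrite -mulrA /n h mulr0.
have lV s : (fun t : R => pot G 0%N (q, t)) @ @infty R s --> (pot (F s) 0%N q : R).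
  by have [_ _ _ _ [_ /(_ q Fq)[+ _ _]]] := HM s.
by rewrite -(first_integral_limit 0 V0 (lV Plus)) -(first_integral_limit 0 V0 (lV Minus)).
Qed.

Lemma front_current_jump :
  \sum_i cur (F Plus) i 0%N q * n_ q 0 i = \sum_i cur (F Minus) i 0%N q * n_ q 0 i.
Proof.
pose Jn t : R := \sum_i n i * cur G i 0%N (q, t).
have HJ (z : R) : is_derive z 1 Jn 0.
  have <- := inner_charge HG z Fq; apply: der_sum => i.
  apply: (is_derive_eq (der_M (der_cst _ _ (n i)) (line z (smooth_cur i 0%N)))).
  by rewrite mulr0 addr0.
have lJ s : Jn @ @infty R s --> \sum_i n i * cur (F s) i 0%N q.
  apply: cvg_sum_infty => i; apply: cvgM; first exact: cvg_cst.
  by have [_ _ _ _ [/(_ i q Fq)[+ _ _] _]] := HM s.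
under eq_bigr do rewrite nE mulrC.
under [RHS]eq_bigr do rewrite nE mulrC.
by rewrite -(first_integral_limit 0 HJ (lJ Plus)) -(first_integral_limit 0 HJ (lJ Minus)).
Qed.

End AtFrontPoint.

Lemma outer_pure s q : bulk s q -> phi (F s) 0%N q = sgn R s.
Proof.
apply: (bulk_phase Hd (outer_smooth_phi s 0%N) (@outer_flat s) (oe_sign (HF s))).
by move=> q' Fq'; rewrite (front_phase Fq'); case: (s) => /=; ring.
Qed.

Lemma viscous_lead_front i j q z : front q -> viscous_lead c d G i j (q, z) = 0.
Proof.
by move=> Fq; rewrite /viscous_lead !(inner_velocity_constant Fq) !mulr0 addr0 !mulr0.
Qed.

(** viscous_lead vanishes on the interface, hence so does its surface gradient. *)
Lemma viscous_lead_tangential i j q z v : front q ->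
  'D_(spatial v) (normal_ext d (viscous_lead c d G i j) z) q = 0.
Proof.
move=> Fq.
have layq : lay (q, z) by [].
have dfst k : differentiable (fun w : stretched R => 'D_(dir_x k) d w.1) (q, z).
  have dd := smooth_near_differentiable (smooth_near_derive (dir_x k) (ei_smooth Hd)) Fq.
  have df : differentiable (fun w : stretched R => w.1) (q, z).
    apply: (@linear_differentiable _ (stretched R) (spacetime R) fst).
    by move=> w; exact: cvg_fst.
  exact: (differentiable_comp df dd).
have du k : differentiable (dz (vel G k 0%N)) (q, z).
  exact: (smooth_near_differentiable (smooth_near_derive dir_z (smooth_vel k 0%N)) layq).
have dphi := smooth_near_differentiable (smooth_phi 0%N) layq.
have dmix : differentiable (fun w => mixture (eta_ c) (phi G 0%N w)) (q, z).
  apply: differentiableD; last exact: differentiable_cst.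
  by apply: differentiableM => //; exact: differentiable_cst.
have dvisc : differentiable (viscous_lead c d G i j : stretched R -> R^o) (q, z).
  apply: differentiableM; first exact: differentiable_cst.
  apply: differentiableM => //; apply: differentiableM; first exact: differentiable_cst.
  by apply: differentiableD; exact: differentiableM.
rewrite (derive_normal_ext Hd v Fq dvisc); apply: (tangential_derive Hd) => //.
- by apply: (@differentiable_comp _ _ _ _ (fun q' : spacetime R => (q', z) : stretched R)).
- by move=> q' Fq'; exact: viscous_lead_front.
- exact: (dot_tangent Hd v Fq).
Qed.

(** Inner and outer leading velocities agree on the interface, so they have the
    same tangential derivatives; the right-hand side removes the normal part of
    the outer gradient. *)
Lemma tangential_velocity s j q z v : front q ->
  'D_(spatial v) (normal_ext d (vel G j 0%N) z) q =
  dot (sgrad (vel (F s) j 0%N) q) v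
  - dot (n_ q) v * dot (sgrad (vel (F s) j 0%N) q) (n_ q).
Proof.
move=> Fq.
have dX : differentiable (vel G j 0%N) (q, z).
  exact: smooth_near_differentiable (smooth_vel j 0%N) _.
have du : differentiable (vel (F s) j 0%N) q.
  by apply: smooth_near_differentiable (outer_smooth_vel s j 0%N) _; right.
have dXz : differentiable (fun q' : spacetime R => vel G j 0%N (q', z)) q.
  by apply: (@differentiable_comp _ _ _ _ (fun q' : spacetime R => (q', z) : stretched R)).
rewrite (derive_normal_ext Hd v Fq dX).
have : 'D_(spatial (tangent d q v)) (fun q' => vel G j 0%N (q', z) - vel (F s) j 0%N q' : R^o) q = 0.
  apply: (tangential_derive Hd) => //; first exact: differentiableB.
    by move=> q' Fq'; rewrite (inner_velocity Fq' s) subrr.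
  exact: (dot_tangent Hd v Fq).
rewrite deriveB; [|exact: diff_derivable|exact: diff_derivable].
move=> /eqP; rewrite subr_eq0 => /eqP ->.
by rewrite derive_spatial // dotBr dotZr.
Qed.

Definition outer_stress s i j (q : spacetime R) : R :=
  2 * (eta_ c s * (2^-1 * ('D_(dir_x i) (vel (F s) j 0%N) q + 'D_(dir_x j) (vel (F s) i 0%N) q)))
  - (i == j)%:R * prs (F s) 0%N q.

(** Matching of d_z u_1 restores the normal derivative of u, which
    tangential_velocity removes: at both ends the layer shows the full outer
    strain rate. *)
Lemma layer_stress_limit s i j q : front q ->
  (fun z => layer_stress c d G i j (q, z)) @ @infty R s --> outer_stress s i j q.
Proof.
move=> Fq; rewrite /layer_stress /outer_stress.
apply: cvgB; last first.
  apply: cvgM; first exact: cvg_cst.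
  by have [_ _ _ /(_ q Fq)[+ _ _] _] := HM s.
apply: cvgM; first exact: cvg_cst.
apply: cvgM.
  rewrite -(mixture_pure (eta_ c) s); apply: cvg_mixture; rewrite -(front_phase Fq s).
  by have [/(_ q Fq)[+ _ _] _ _ _ _] := HM s.
apply: cvgM; first exact: cvg_cst.
have half a b : (fun z => 'D_(dir_x a) d q * dz (vel G b 1%N) (q, z)
     + 'D_(dir_x a) (normal_ext d (vel G b 0%N) z) q) @ @infty R s -->
   ('D_(dir_x a) (vel (F s) b 0%N) q : R).
  have -> : (fun z => 'D_(dir_x a) d q * dz (vel G b 1%N) (q, z)
     + 'D_(dir_x a) (normal_ext d (vel G b 0%N) z) q) =
    (fun z => 'D_(dir_x a) d q * dz (vel G b 1%N) (q, z)
     + ('D_(dir_x a) (vel (F s) b 0%N) q - 'D_(dir_x a) d q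
        * dot (sgrad (vel (F s) b 0%N) q) (n_ q))).
    apply/funext => z; congr (_ + _).
    rewrite -[dir_x a]/(spatial (delta_mx 0 a)) (tangential_velocity s) // !dot_delta.
    by rewrite !mxE.
  rewrite -[X in _ --> X](subrKC ('D_(dir_x a) d q * dot (sgrad (vel (F s) b 0%N) q) (n_ q))).
  apply: cvgD; last exact: cvg_cst.
  apply: cvgM; first exact: cvg_cst.
  by have [_ _ /(_ b q Fq)[_ _ +] _ _] := HM s.
by apply: cvgD; exact: half.
Qed.

Lemma layer_stress_line i j q (z : R) : front q ->
  is_derive z 1 (fun t : R => layer_stress c d G i j (q, t)) (dz (layer_stress c d G i j) (q, z)).
Proof.
move=> Fq.
have line X : smooth_near lay X -> is_derive z 1 (fun t : R => X (q, t)) (dz X (q, z)).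
  by move=> sX; exact: smooth_derive_z sX _.
have Hu k := line _ (smooth_near_derive dir_z (smooth_vel k 1%N)).
have Hp := line _ (smooth_prs 0%N).
have Hphi := line _ (smooth_phi 0%N).
pose tau a b := dot (sgrad (vel (F Plus) b 0%N) q) (delta_mx 0 a)
  - dot (n_ q) (delta_mx 0 a) * dot (sgrad (vel (F Plus) b 0%N) q) (n_ q).
have E : (fun t : R => layer_stress c d G i j (q, t)) = (fun t : R =>
    2 * (mixture (eta_ c) (phi G 0%N (q, t)) * (2^-1 *
      (('D_(dir_x i) d q * dz (vel G j 1%N) (q, t) + tau i j)
     + ('D_(dir_x j) d q * dz (vel G i 1%N) (q, t) + tau j i))))
    - (i == j)%:R * prs G 0%N (q, t)).
  apply/funext => t; rewrite /layer_stress /layer_strain /=.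
  by rewrite -![dir_x _]/(spatial _) !(tangential_velocity Plus _ t _ Fq).
have H1 a b := der_D (der_M (der_cst z 1 ('D_(dir_x a) d q : R)) (Hu b)) (der_cst z 1 (tau a b)).
have H2 := der_M (der_cst z 1 (2^-1 : R)) (der_D (H1 i j) (H1 j i)).
have H3 := der_M (der_cst z 1 (2 : R)) (der_M (der_mixture (eta_ c) Hphi) H2).
have H4 := der_B H3 (der_M (der_cst z 1 ((i == j)%:R : R)) Hp).
rewrite -E in H4; exact: (is_derive_z H4).
Qed.

Lemma outer_phase_gradient s i q : front q -> 'D_(dir_x i) (phi (F s) 0%N) q = 0.
Proof.
move=> Fq; have inA : (bulk s `|` front) q by right.
have cg := smooth_near_continuous (smooth_near_derive (dir_x i) (outer_smooth_phi s 0%N)) inA.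
apply: (trace_eq0 Hd (s := s) Fq cg).
move=> q' Bq'.
transitivity ('D_(dir_x i) (fun=> sgn R s : R^o) q'); last exact: derive_cst.
exact: (derive_bulk Hd (delta_mx 0 i) Bq' (@outer_pure s)).
Qed.

(** At order eps^-1 the normal stress changes across the layer at the rate
    - mu_1 d_z phi_0 n, whose integral is the surface tension. *)
Lemma front_stress_jump i q : front q ->
  \sum_j (outer_stress Plus i j q - outer_stress Minus i j q) * n_ q 0 j
  = - (lambda c * kappa d q * n_ q 0 i).
Proof.
move=> Fq.
have line X z : smooth_near lay X -> is_derive (z : R) 1 (fun t : R => X (q, t)) (dz X (q, z)).
  by move=> sX; exact: smooth_derive_z sX _.
have Hph z := line _ z (smooth_phi 0%N).
pose S t : R := \sum_j n_ q 0 j * layer_stress c d G i j (q, t).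
have lS s : S @ @infty R s --> \sum_j n_ q 0 j * outer_stress s i j q.
  apply: cvg_sum_infty => j; apply: cvgM; first exact: cvg_cst.
  exact: layer_stress_limit.
have HS (z : R) : is_derive z 1 S (- (n_ q 0 i * mu G 1%N (q, z) * dz (phi G 0%N) (q, z))).
  have E := inner_momentum_next HG Fq (fun z' k => inner_velocity_constant Fq k z')
    (potential_zero Fq z) (fun j => viscous_lead_tangential i j z (delta_mx 0 j) Fq).
  have -> : - (n_ q 0 i * mu G 1%N (q, z) * dz (phi G 0%N) (q, z)) =
      \sum_j n_ q 0 j * dz (layer_stress c d G i j) (q, z).
    under eq_bigr do rewrite mxE.
    by rewrite mxE; move/eqP: E; rewrite eq_sym addr_eq0 => /eqP ->; ring.
  apply: der_sum => j; apply: (is_derive_eq (der_M (der_cst _ _ _) (layer_stress_line i j z Fq))).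
  by rewrite mulr0 addr0.
transitivity (\sum_j n_ q 0 j * outer_stress Plus i j q - \sum_j n_ q 0 j * outer_stress Minus i j q).
  by rewrite -sumrB; apply: eq_bigr => j _; ring.
have muE z : mu G 1%N (q, z) = 3 * lambda c / (2 * Num.sqrt 2) *
    (- dz (dz (phi G 1%N)) (q, z) + kappa d q * dz (phi G 0%N) (q, z)
     + (3 * phi G 0%N (q, z) ^+ 2 - 1) * phi G 1%N (q, z)).
  exact: (ie_mu1 HG (w := (q, z)) Fq).
have lphi s : (fun z => phi G 0%N (q, z)) @ @infty R s --> sgn R s.
  by rewrite -(front_phase Fq s); have [/(_ q Fq)[+ _ _] _ _ _ _] := HM s.
have ldphi s : (fun z => dz (phi G 0%N) (q, z)) @ @infty R s --> (0 : R).
  by have [/(_ q Fq)[_ + _] _ _ _ _] := HM s.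
have ldphi1 s : (fun z => dz (phi G 1%N) (q, z)) @ @infty R s --> (0 : R).
  rewrite -[X in _ --> X](_ : dot (sgrad (phi (F s) 0%N) q) (n_ q) = 0).
    by have [/(_ q Fq)[_ _ +] _ _ _ _] := HM s.
  by rewrite /dot big1 // => k _; rewrite mxE outer_phase_gradient // mul0r.
have Hphi1 z := line _ z (smooth_phi 1%N).
have Hdphi1 z := line _ z (smooth_near_derive dir_z (smooth_phi 1%N)).
have HS' (z : R) := is_derive_eq (HS z) (congr1 (fun m => - (n_ q 0 i * m * _)) (muE z)).
exact: (surface_tension Hph (profile_derive2 Fq) (profile_eq Fq) lphi ldphi Hphi1 Hdphi1 ldphi1 HS' lS).
Qed.

End Limit.

Lemma function_stressE (R : realType) (A : set (spacetime R)) (k : R)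
    (u : 'I_3 -> spacetime R -> R^o) (p : spacetime R -> R^o) i j :
  stress (C := function_calculus A) (k *: cone _) u p i j = fun q : spacetime R =>
    2 * (k * (2^-1 * ('D_(dir_x i) (u j) q + 'D_(dir_x j) (u i) q))) - (i == j)%:R * p q.
Proof.
apply/funext => q; rewrite -[in RHS](mulr1 k).
by [].
Qed.

Theorem theorem1 (R : realType) (c : parameters R) (Omega : set 'rV[R]_3)
    (T : R) (d : spacetime R -> R^o)
    (phi_init : nat -> 'rV[R]_3 -> R) (vel_init : 'I_3 -> nat -> 'rV[R]_3 -> R)
    (F : side -> fields (nat -> spacetime R -> R^o))
    (G : fields (nat -> stretched R -> R^o)) :
  parameters_pos c ->
  evolving_interface Omega T d ->
  (forall s, outer_expansion c Omega T d phi_init vel_init s (F s)) ->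
  inner_expansion c Omega T d G ->
  (forall s, all_fields2 (matched Omega T d s) G (F s)) ->
  sharp_interface_system c Omega T d
    (fun s i => vel (F s) i 0%N) (fun s => prs (F s) 0%N)
    (fun s i => cur (F s) i 0%N)
    (fun s i q => - 'D_(dir_x i) (pot (F s) 0%N) q)
    (fun s => pot (F s) 0%N).
Proof.
move=> Hc Hd HF HG HM.
have pure s q := @outer_pure R c Omega T d phi_init vel_init F G Hc Hd HF HG HM s q.
split.
- move=> s i C q Bq.
  have := outer_momentum0 (HF s) (pure s) Hd i Bq.
  have <- := congr1 (fun f => f q) (fct_sumE (index_enum 'I_3) xpredT
    (fun j q => vel (F s) j 0%N q * 'D_(dir_x j) (vel (F s) i 0%N) q)).
  have S j : 'D_(dir_x j) (fun q => 2 * (eta_ c s * (2^-1 * ('D_(dir_x i) (vel (F s) j 0%N) q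
      + 'D_(dir_x j) (vel (F s) i 0%N) q))) - (i == j)%:R * prs (F s) 0%N q) q
    = cdx (c := C) j (stress (eta_ c s *: cone C) (fun i => vel (F s) i 0%N) (prs (F s) 0%N) i j) q.
    by rewrite function_stressE.
  rewrite (eq_bigr _ (fun j _ => S j)) (mulrC (gvec _ _ _)).
  have <- := congr1 (fun f => f q) (fct_sumE (index_enum 'I_3) xpredT
    (fun j => cdx (c := C) j (stress (eta_ c s *: cone C) (fun i => vel (F s) i 0%N)
       (prs (F s) 0%N) i j))).
  move=> H; rewrite /advect /tdiv /cross /=.
  by rewrite -[rho_ c s * gvec c 0 i]mulr1 in H; exact: H.
- move=> s C q Bq.
  have := outer_incompressible (HF s) Bq.
  by rewrite /vdiv fct_sumE.
- move=> s i C q Bq.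
  have := outer_ohm (HF s) i Bq.
  rewrite pure // mixture_pure.
  exact.
- by [].
- move=> s C q Bq.
  have := outer_charge (HF s) Bq.
  by rewrite /vdiv fct_sumE.
- move=> q i Fq S.
  rewrite -(front_stress_jump Hc Hd HF HG HM i Fq); apply: eq_bigr => j _.
  congr ((_ - _) * _).
    by rewrite /S function_stressE.
  by rewrite /S function_stressE.
- by move=> q i Fq; rewrite -!(inner_velocity Hc Hd HF HG HM Fq _ _ 0) subrr.
- by move=> q Fq; rewrite (front_current_jump HG HM Fq) subrr.
- by move=> q Fq; rewrite (front_potential_jump Hc Hd HF HG HM Fq) subrr.
- by move=> s q Fq; exact: (front_kinematic Hc Hd HF HG HM Fq).
Qed.
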